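(* Let $p\ge 1$ and $q\in\{p,p-1\}$. Let an explicit GLM $(\mathbf{c}^{\{E\}},\mathbf{A}^{\{E\}},\mathbf{U}^{\{E\}},\mathbf{B}^{\{E\}},\mathbf{V}^{\{E\}})$ and an implicit GLM $(\mathbf{c}^{\{I\}},\mathbf{A}^{\{I\}},\mathbf{U}^{\{I\}},\mathbf{B}^{\{I\}},\mathbf{V}^{\{I\}})$ be given, both with $s$ internal and $r$ external stages, such that $$\mathbf{c}^{\{E\}}=\mathbf{c}^{\{I\}}=\mathbf{c},\qquad \mathbf{U}^{\{E\}}=\mathbf{U}^{\{I\}}=\mathbf{U},\qquad \mathbf{V}^{\{E\}}=\mathbf{V}^{\{I\}}=\mathbf{V}.$$ Consider an $N$-way partitioned ADI-GLM ($N\ge 2$) built from this pair, i.e. the scheme $$Y_i^{\{\mu\}} = h\sum_{\sigma=1}^{N}\sum_{j=1}^{s}a^{\{\mu,\sigma\}}_{i,j} f^{\{\sigma\}}(Y_j^{\{\sigma\}}) + \sum_{\sigma=1}^{N}\sum_{j=1}^{r} u_{i,j}^{\{\mu, \sigma\}}\,\xi_j^{\{\sigma\}[n-1]},\qquad i=1,\dots,s,\ \mu=1,\dots,N,$$ $$\xi_i^{\{\mu\}[n]} = h \sum_{\sigma=1}^{N}\sum_{j=1}^{s} b_{i,j}^{\{\mu,\sigma\}} f^{\{\sigma\}}(Y_j^{\{\sigma\}}) + \sum_{\sigma=1}^{N}\sum_{j=1}^{r} v_{i,j}^{\{\mu,\sigma\}}\, \xi_j^{\{\sigma\}[n-1]},\qquad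 i=1,\dots,r,\ \mu=1,\dots,N,$$ with all abscissae $\mathbf{c}^{\{\mu\}}=\mathbf{c}$, with each pair $(\mathbf{A}^{\{\mu,\sigma\}},\mathbf{B}^{\{\mu,\sigma\}})$ equal to $(\mathbf{A}^{\{E\}},\mathbf{B}^{\{E\}})$ or to $(\mathbf{A}^{\{I\}},\mathbf{B}^{\{I\}})$ according to an ADI pattern (see context), and with $$\mathbf{U}^{\{\sigma,\mu\}}=\begin{cases}\mathbf{0}&\sigma\ne\mu\\ \mathbf{U}&\sigma=\mu\end{cases},\qquad \mathbf{V}^{\{\sigma,\mu\}}=\begin{cases}\mathbf{0}&\sigma\ne\mu\\ \mathbf{V}&\sigma=\mu\end{cases}.$$ Then the ADI-GLM has stage order $q$ and order $p$ (denoted order $(q,p)$) if and only if the individual explicit and implicit methods of the pair have order $(q,p)$.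
   Context: **Problem.** The methods are applied to initial value problems $y'(t)=f(y)=\sum_{\sigma=1}^N f^{\{\sigma\}}(y)$, $y(t_0)=y_0$, with $f^{\{\sigma\}}:\mathbb{R}^d\to\mathbb{R}^d$ sufficiently smooth; $h$ is the step size and $t_n=t_{n-1}+h$. The notation $(f^{\{\sigma\}})^{(k-1)}(y(t))$ means $\frac{d^{k-1}}{dt^{k-1}}f^{\{\sigma\}}(y(t))$ along the exact solution. Scalar coefficients multiply vectors in $\mathbb{R}^d$. **General linear method (GLM).** A GLM with $s$ internal and $r$ external stages has coefficients $\mathbf{c}\in\mathbb{R}^s$, $\mathbf{A}=[a_{i,j}]\in\mathbb{R}^{s\times s}$, $\mathbf{U}=[u_{i,j}]\in\mathbb{R}^{s\times r}$, $\mathbf{B}=[b_{i,j}]\in\mathbb{R}^{r\times s}$, $\mathbf{V}=[v_{i,j}]\in\mathbb{R}^{r\times r}$ and advances $y'=f(y)$ by $$Y_i=h\sum_{j=1}^s a_{i,j}f(Y_j)+\sum_{j=1}^r u_{i,j}\xi_j^{[n-1]},\qquad \xi_i^{[n]}=h\sum_{j=1}^s b_{i,j}f(Y_j)+\sum_{j=1}^r v_{i,j}\xi_j^{[n-1]}.$$ It is explicit if $\mathbf{A}$ is strictly lower triangular, and (diagonally) implicit if $\mathbf{A}$ is lower triangular with nonzero diagonal. **Order of a GLM.** A GLM has order $p$ and stage order $q$ if there is a matrix $\mathbf{W}=[w_{i,k}]=[\mathbf{w}_0\;\cdots\;\mathbf{w}_p]\in\mathbb{R}^{r\times(p+1)}$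 such that, for every smooth problem, whenever $\xi_i^{[n-1]}=\sum_{k=0}^p w_{i,k}h^k y^{(k)}(t_{n-1})+\mathcal{O}(h^{p+1})$ for all $i$, one step gives $Y_i=y(t_{n-1}+c_ih)+\mathcal{O}(h^{q+1})$ for $i=1,\dots,s$ and $\xi_i^{[n]}=\sum_{k=0}^p w_{i,k}h^k y^{(k)}(t_n)+\mathcal{O}(h^{p+1})$ for $i=1,\dots,r$. The explicit and implicit methods of the pair each have their own matrix, $\mathbf{W}^{\{E\}}$ and $\mathbf{W}^{\{I\}}$. **Order of an ADI-GLM.** An $N$-way partitioned ADI-GLM has order $p$ and stage order $q$ if there are coefficients $w_{i,0}^{\{\mu\}}$ and $w_{i,k}^{\{\mu,\sigma\}}$ ($1\le i\le r$, $1\le k\le p$, $1\le\mu,\sigma\le N$) such that, for every smooth partitioned problem, whenever the relations $$\xi_i^{\{\mu\}[m]} = w_{i,0}^{\{\mu\}}\, y(t_m) + \sum_{\sigma=1}^{N} \sum_{k=1}^{p} w_{i,k}^{\{\mu,\sigma\}} h^k (f^{\{\sigma\}})^{(k-1)}(y(t_m)) + \mathcal{O}(h^{p+1})\quad\text{for all } i,\mu$$ hold for $m=n-1$, one step gives the same relations for $m=n$, and also $Y_i^{\{\mu\}}=y(t_{n-1}+c_i^{\{\mu\}}h)+\mathcal{O}(h^{q+1})$ for all $i,\mu$. **ADI pattern.** $\mathbf{A}^{\{\mu,\sigma\}}=[a^{\{\mu,\sigma\}}_{i,j}]$, and likewise for $\mathbf{B},\mathbf{U},\mathbf{V}$. For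 each $(\mu,\sigma)$, the blocks $\mathbf{A}^{\{\mu,\sigma\}}$ and $\mathbf{B}^{\{\mu,\sigma\}}$ are both taken from the explicit method or both taken from the implicit method, and at least one block row $\mu$ uses both methods. The typical patterns are: - $N$ stiff partitions: the implicit method for $\sigma\le\mu$ and the explicit method for $\sigma>\mu$. - $N=3$ with a non-stiff third partition: $(\mathbf{A}^{\{\mu,\sigma\}})_{\mu,\sigma}=\begin{bmatrix}\mathbf{A}^{\{I\}}&\mathbf{A}^{\{E\}}&\mathbf{A}^{\{E\}}\\ \mathbf{A}^{\{I\}}&\mathbf{A}^{\{I\}}&\mathbf{A}^{\{E\}}\\ \mathbf{A}^{\{I\}}&\mathbf{A}^{\{I\}}&\mathbf{A}^{\{E\}}\end{bmatrix}$, and the same pattern for $\mathbf{B}$.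
   Formalization: The two methods are required to have order (q,p) with matrices W^{E}, W^{I} sharing the same first column w_0; with unrelated first columns the ''if'' direction is false. For implicit methods, stages are taken to be the solutions that stay bounded as h tends to 0. *)

(* Defs.v *)
From HB Require Import structures.
From mathcomp Require Export all_boot all_order all_algebra.
From mathcomp Require Export all_classical all_reals.
From mathcomp Require Export ereal topology normedtype landau derive.
Export numFieldNormedType.Exports.

Set Implicit Arguments.
Unset Strict Implicit.
Unset Printing Implicit Defensive.

Import Order.TTheory GRing.Theory Num.Theory.

Local Open Scope classical_set_scope.
Local Open Scope ring_scope.

Fixpoint Ck (R : realType) (V W : normedModType R) (k : nat) (f : V -> W) :
    Prop :=
  if k is k'.+1 then
    (forall x, differentiable f x) /\ (forall v, Ck k' (fun x => 'D_v f x))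
  else continuous f.

Definition smooth (R : realType) (V W : normedModType R) (f : V -> W) : Prop :=
  forall k, Ck k f.

(* The solution is required on both sides of [t]: as [f] is defined on the
   whole space, a solution starting at [t] extends to the left. *)
Definition solves_near (R : realType) (V : normedModType R) (f : V -> V)
    (y : R -> V) (t : R) : Prop :=
  \forall u \near t, is_derive u (1 : R) y (f (y u)).

(* [g h = O(h ^ k)] as the step size [h] decreases to 0 *)
Definition Oh (R : realType) (V : normedModType R) (k : nat) (g : R -> V) :
    Prop :=
  g =O_ (0^'+) (fun h : R => h ^+ k : R^o).

Record glm (R : realType) (s r : nat) := Glm {
  glm_c : 'I_s -> R;
  glm_A : 'M[R]_s;
  glm_U : 'M[R]_(s, r);
  glm_B : 'M[R]_(r, s);
  glm_V : 'M[R]_r }.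

Section Glm.
Context {R : realType} {s r : nat}.
Implicit Type G : glm R s r.

Definition glm_explicit G : Prop :=
  forall i j : 'I_s, (i <= j)%N -> glm_A G i j = 0.

Definition glm_implicit G : Prop :=
  (forall i j : 'I_s, (i < j)%N -> glm_A G i j = 0) /\
  (forall i, glm_A G i i != 0).

Definition glm_step d G (f : 'rV[R]_d -> 'rV[R]_d) (h : R)
    (xi : 'I_r -> 'rV[R]_d) (Y : 'I_s -> 'rV[R]_d) (xi' : 'I_r -> 'rV[R]_d) :
    Prop :=
  (forall i, Y i = h *: (\sum_j glm_A G i j *: f (Y j))
                   + \sum_j glm_U G i j *: xi j) /\
  (forall i, xi' i = h *: (\sum_j glm_B G i j *: f (Y j))
                     + \sum_j glm_V G i j *: xi j).

Definition glm_external d p (W : 'M[R]_(r, p.+1)) (y : R -> 'rV[R]_d)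
    (h t : R) (i : 'I_r) : 'rV[R]_d :=
  \sum_(k < p.+1) (W i k * h ^+ k) *: derive1n k y t.

(* The data of a step are families indexed by the step size [h], and [t]
   stands for [t_(n-1)].  The stage equations of an implicit method may have
   several solutions; the stages of the step are those that stay bounded as
   [h] tends to 0, the others (e.g. the second root of [Y = x + h * a * Y ^ 2])
   blow up.  For an explicit method boundedness is automatic. *)
Definition glm_order_with (p q : nat) G (W : 'M[R]_(r, p.+1)) : Prop :=
  forall (d : nat) (f : 'rV[R]_d -> 'rV[R]_d) (y : R -> 'rV[R]_d) (t : R)
    (xi : R -> 'I_r -> 'rV[R]_d) (Y : R -> 'I_s -> 'rV[R]_d)
    (xi' : R -> 'I_r -> 'rV[R]_d),
  smooth f -> solves_near f y t ->
  (\forall h \near 0^'+, glm_step G f h (xi h) (Y h) (xi' h)) ->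
  (forall i, Oh 0 (fun h => Y h i)) ->
  (forall i, Oh p.+1 (fun h => xi h i - glm_external W y h t i)) ->
  (forall i, Oh q.+1 (fun h => Y h i - y (t + glm_c G i * h))) /\
  (forall i, Oh p.+1 (fun h => xi' h i - glm_external W y h (t + h) i)).

(* Each method of the pair has its own matrix [W], but the two matrices share
   the first column (the coefficients of [y] itself), as the external vectors
   of a partitioned method carry a single coefficient of [y].  This does not
   follow from the two orders: take [s = 1], [r = 2], [p = 1], [q = 0],
   [c = 0], [U = (1/2 1/2)], [V = 1], with [A = 0], [B = (1 1)^T] for the
   explicit method and [A = 1], [B = (2 0)^T] for the implicit one.  Both have
   order 1, but only with first columns [(1 1)^T] and [(2 0)^T], and a
   partitioned method with a block row using both does not have order 1. *)
Definition glm_pair_order (p q : nat) (GE GI : glm R s r) : Prop :=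
  exists WE WI : 'M[R]_(r, p.+1),
    [/\ glm_order_with q GE WE, glm_order_with q GI WI &
        forall i, WE i ord0 = WI i ord0].

End Glm.

Record pglm (R : realType) (N s r : nat) := Pglm {
  pglm_c : 'I_N -> 'I_s -> R;
  pglm_A : 'I_N -> 'I_N -> 'M[R]_s;
  pglm_U : 'I_N -> 'I_N -> 'M[R]_(s, r);
  pglm_B : 'I_N -> 'I_N -> 'M[R]_(r, s);
  pglm_V : 'I_N -> 'I_N -> 'M[R]_r }.

Section Pglm.
Context {R : realType} {N s r : nat}.
Implicit Type M : pglm R N s r.

Definition pglm_step d M (f : 'I_N -> 'rV[R]_d -> 'rV[R]_d) (h : R)
    (xi : 'I_N -> 'I_r -> 'rV[R]_d) (Y : 'I_N -> 'I_s -> 'rV[R]_d)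
    (xi' : 'I_N -> 'I_r -> 'rV[R]_d) : Prop :=
  (forall mu i, Y mu i =
     h *: (\sum_sigma \sum_j pglm_A M mu sigma i j *: f sigma (Y sigma j))
     + \sum_sigma \sum_j pglm_U M mu sigma i j *: xi sigma j) /\
  (forall mu i, xi' mu i =
     h *: (\sum_sigma \sum_j pglm_B M mu sigma i j *: f sigma (Y sigma j))
     + \sum_sigma \sum_j pglm_V M mu sigma i j *: xi sigma j).

(* [w mu sigma i k] is used for [1 <= k <= p] only. *)
Definition pglm_external d (p : nat) (w0 : 'I_N -> 'I_r -> R)
    (w : 'I_N -> 'I_N -> 'I_r -> nat -> R) (f : 'I_N -> 'rV[R]_d -> 'rV[R]_d)
    (y : R -> 'rV[R]_d) (h t : R) (mu : 'I_N) (i : 'I_r) : 'rV[R]_d :=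
  w0 mu i *: y t
  + \sum_sigma \sum_(1 <= k < p.+1)
      (w mu sigma i k * h ^+ k) *: derive1n k.-1 (fun u => f sigma (y u)) t.

Definition pglm_order (p q : nat) M : Prop :=
  exists (w0 : 'I_N -> 'I_r -> R) (w : 'I_N -> 'I_N -> 'I_r -> nat -> R),
  forall (d : nat) (f : 'I_N -> 'rV[R]_d -> 'rV[R]_d) (y : R -> 'rV[R]_d)
    (t : R) (xi : R -> 'I_N -> 'I_r -> 'rV[R]_d)
    (Y : R -> 'I_N -> 'I_s -> 'rV[R]_d) (xi' : R -> 'I_N -> 'I_r -> 'rV[R]_d),
  (forall sigma, smooth (f sigma)) ->
  solves_near (fun x => \sum_sigma f sigma x) y t ->
  (\forall h \near 0^'+, pglm_step M f h (xi h) (Y h) (xi' h)) ->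
  (forall mu i, Oh 0 (fun h => Y h mu i)) ->
  (forall mu i,
     Oh p.+1 (fun h => xi h mu i - pglm_external p w0 w f y h t mu i)) ->
  (forall mu i, Oh q.+1 (fun h => Y h mu i - y (t + pglm_c M mu i * h))) /\
  (forall mu i,
     Oh p.+1 (fun h => xi' h mu i - pglm_external p w0 w f y h (t + h) mu i)).

(* [impl mu sigma] tells that the block [(mu, sigma)] is implicit. *)
Definition adi_pattern (impl : 'I_N -> 'I_N -> bool) : Prop :=
  exists mu sigma tau, impl mu sigma /\ ~~ impl mu tau.

Definition adi_glm (GE GI : glm R s r) (impl : 'I_N -> 'I_N -> bool) M : Prop :=
  [/\ adi_pattern impl,
      forall mu, pglm_c M mu = glm_c GE,
      forall mu sigma, (pglm_A M mu sigma, pglm_B M mu sigma) =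
        if impl mu sigma then (glm_A GI, glm_B GI) else (glm_A GE, glm_B GE),
      forall sigma mu,
        pglm_U M sigma mu = if sigma == mu then glm_U GE else 0 &
      forall sigma mu,
        pglm_V M sigma mu = if sigma == mu then glm_V GE else 0].

End Pglm.

(* Main.v *)
From HB Require Import structures.
Require Import Defs.
From mathcomp Require Import ring lra.

(* Both orders are equivalent to the same algebraic conditions.  Write the
   stages and the external vectors as expansions in [y(t)] and in the
   derivatives [h^k (f^{sigma})^(k-1)(y(t))], [k >= 1].  As [U] and [V] are block
   diagonal and all abscissae agree, the coefficients in block row [mu] of the
   terms with index [sigma] only involve [A^{mu,sigma}], [B^{mu,sigma}],
   [w_0^{mu}] and [w_k^{mu,sigma}]: they vanish exactly when the method
   [(c, A^{mu,sigma}, U, B^{mu,sigma}, V)] satisfies the order conditions with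
   these coefficients ([order_cond]).
   The conditions are sufficient because smooth functions are Lipschitz on
   bounded sets, so that the stage errors satisfy [E <= h K E + O(h^(q+1))].
   They are necessary because of the problems [(y_0, y_1)' = (1, y_0^n)], with
   the whole right-hand side put in the partition [sigma]; there the stages of
   an implicit method are explicit polynomials in [h].
   The theorem for a single method is the case [N = 1].  A block row which uses
   both methods provides [W^{E}] and [W^{I}] with a common first column. *)

Set Implicit Arguments.
Unset Strict Implicit.
Unset Printing Implicit Defensive.

Import Order.TTheory GRing.Theory Num.Theory.

Local Open Scope classical_set_scope.
Local Open Scope ring_scope.

(** * Growth bounds and the mean value inequality *)

Section Oh_theory.
Context {R : realType} {V : normedModType R}.
Implicit Types (k m n : nat) (g : R -> V) (v : V).

(** The working form of the Landau notation: [C] may have any sign, and [h ^+ k] needs no norm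
    because [h] is positive near [0^'+]. *)
Lemma OhP k g :
  Oh k g <-> exists C, \forall h \near 0^'+, `|g h| <= C * h ^+ k.
Proof.
rewrite /Oh eqO_exP; split=> [[C _ gC]|[C gC]].
  exists C; near=> h.
  have h0 : 0 < h by near: h; exact: nbhs_right_gt.
  rewrite -[X in _ * X]gtr0_norm ?exprn_gt0//.
  by near: h; exact: gC.
exists (`|C| + 1); first by rewrite ltr_wpDl.
near=> h.
have h0 : 0 < h by near: h; exact: nbhs_right_gt.
rewrite [X in _ * X]gtr0_norm ?exprn_gt0//.
apply: le_trans (_ : C * h ^+ k <= _); first by near: h; exact: gC.
by rewrite ler_wpM2r ?exprn_ge0 ?(ltW h0)// (le_trans (ler_norm _)) ?lerDl.
Unshelve. all: by end_near. Qed.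

Lemma Oh_near k g1 g2 :
  (\forall h \near 0^'+, g1 h = g2 h) -> Oh k g1 -> Oh k g2.
Proof.
move=> e /OhP[C gC]; apply/OhP; exists C; near=> h.
have <- : g1 h = g2 h by near: h.
by near: h.
Unshelve. all: by end_near. Qed.

Lemma Oh0 k : Oh k (fun=> 0 : V).
Proof.
by apply/OhP; exists 0; near=> h; rewrite normr0 mul0r.
Unshelve. all: by end_near. Qed.

Lemma OhD k g1 g2 : Oh k g1 -> Oh k g2 -> Oh k (fun h => g1 h + g2 h).
Proof.
move=> /OhP[C1 H1] /OhP[C2 H2]; apply/OhP; exists (C1 + C2); near=> h.
apply: le_trans (ler_normD _ _) _; rewrite mulrDl lerD//; by near: h.
Unshelve. all: by end_near. Qed.

Lemma OhN k g : Oh k g -> Oh k (fun h => - g h).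
Proof.
by move=> /OhP[C H]; apply/OhP; exists C; near do rewrite normrN.
Unshelve. all: by end_near. Qed.

Lemma OhZ k (a : R) g : Oh k g -> Oh k (fun h => a *: g h).
Proof.
move=> /OhP[C H]; apply/OhP; exists (`|a| * C); near=> h.
by rewrite normrZ -mulrA ler_wpM2l//; near: h.
Unshelve. all: by end_near. Qed.

Lemma Oh_sum k (I : Type) (r : seq I) (P : pred I) (g : I -> R -> V) :
  (forall i, P i -> Oh k (g i)) -> Oh k (fun h => \sum_(i <- r | P i) g i h).
Proof.
move=> H; elim: r => [|i r IH].
  by apply: (Oh_near _ (Oh0 k)); near=> h; rewrite big_nil.
apply: (@Oh_near _ (fun h => (if P i then g i h else 0) + \sum_(j <- r | P j) g j h)).
  by near=> h; rewrite big_cons; case: ifP; rewrite ?add0r.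
by apply: OhD => //; have := H i; case: (P i) => [|_]; [exact|exact: Oh0].
Unshelve. all: by end_near.
Qed.

Lemma Oh_shift k n g : Oh k g -> Oh (n + k) (fun h => h ^+ n *: g h).
Proof.
move=> /OhP[C H]; apply/OhP; exists C; near=> h.
have h0 : 0 < h by near: h; exact: nbhs_right_gt.
rewrite normrZ gtr0_norm ?exprn_gt0// exprD mulrCA ler_wpM2l ?exprn_ge0 ?(ltW h0)//.
by near: h.
Unshelve. all: by end_near. Qed.

Lemma Oh_le k n g : (k <= n)%N -> Oh n g -> Oh k g.
Proof.
move=> kn /OhP[C H]; apply/OhP; exists `|C|; near=> h.
have h0 : 0 < h by near: h; exact: nbhs_right_gt.
have h1 : h < 1 by near: h; exact: nbhs_right_lt.
apply: le_trans (_ : C * h ^+ n <= _); first by near: h.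
apply: le_trans (_ : `|C| * h ^+ n <= _).
  by rewrite ler_wpM2r ?exprn_ge0 ?(ltW h0)// ler_norm.
by rewrite ler_wpM2l// ler_wiXn2l// ?ltW.
Unshelve. all: by end_near. Qed.

Lemma Oh_monomial k n v : (k <= n)%N -> Oh k (fun h => h ^+ n *: v).
Proof.
move=> kn; apply: (Oh_le kn); have := @Oh_shift 0 n (fun=> v); rewrite addn0; apply.
apply/OhP; exists `|v|; near=> h; rewrite expr0 mulr1; exact: lexx.
Unshelve. all: by end_near. Qed.

(** Dividing by [h ^+ n] leaves [|v| <= C * h] for all small [h]. The necessity proof uses this to
    read off the coefficients one by one. *)
Lemma Oh_monomial_eq0 k n v : (n < k)%N -> Oh k (fun h => h ^+ n *: v) -> v = 0.
Proof.
move=> nk /(Oh_le nk)/OhP[C H]; apply/eqP; rewrite -normr_le0.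
apply/ler_addgt0Pr => e e0; rewrite add0r.
near (0 : R)^'+ => h.
have h0 : 0 < h by near: h; exact: nbhs_right_gt.
have : `|h ^+ n *: v| <= C * h ^+ n.+1 by near: h.
rewrite normrZ gtr0_norm ?exprn_gt0// exprS mulrA [C * h * _]mulrC.
rewrite ler_pM2l ?exprn_gt0// => /le_trans; apply.
apply: le_trans (_ : (`|C| + 1) * h <= _).
  by rewrite ler_pM2r// (le_trans (ler_norm _)) ?lerDl.
rewrite mulrC -ler_pdivlMr ?ltr_wpDl//.
by near: h; apply: nbhs_right_le; rewrite divr_gt0// ltr_wpDl.
Unshelve. all: by end_near. Qed.

End Oh_theory.

Section row_vectors.
Context {R : realType} {d : nat}.
Implicit Types v : 'rV[R]_d.

Lemma ler_coord_norm v j : `|v 0 j| <= `|v|.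
Proof.
rewrite [leRHS]/Num.Def.normr/= mx_normrE.
by apply: (le_trans _ (le_bigmax _ (fun i => `|v i.1 i.2|) (0, j))).
Qed.

Lemma rV_norm_le v (C : R) : 0 <= C -> (forall j, `|v 0 j| <= C) -> `|v| <= C.
Proof.
move=> C0 H; rewrite [leLHS]/Num.Def.normr/= mx_normrE; apply: bigmax_le => // -[i j] _.
by rewrite ord1; exact: H.
Qed.

(** The norm of a row is the maximum of its coordinates, so the scalar mean value theorem applies to
    each coordinate. The hypothesis is symmetric around [a], which covers both orders of [a] and
    [b]. *)
Lemma mean_value_ineq (g : R -> 'rV[R]_d) (a b C : R) :
  (forall x, `|x - a| <= `|b - a| -> derivable g x 1 /\ `|derive1 g x| <= C) ->
  `|g b - g a| <= C * `|b - a|.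
Proof.
move=> H.
have C0 : 0 <= C.
  by have [|_] := H a; [rewrite subrr normr0|exact: le_trans (normr_ge0 _)].
apply: rV_norm_le => [|j]; first by rewrite mulr_ge0.
pose gj x := g x 0 j.
have gj' x : `|x - a| <= `|b - a| -> is_derive x 1 gj (derive1 g x 0 j).
  move=> /H[gx _]; apply: DeriveDef; first by move/derivable_mxP: gx; exact.
  by rewrite derive1E derive_mx// mxE.
have gjC x : `|x - a| <= `|b - a| -> `|derive1 g x 0 j| <= C.
  by move=> /H[_]; apply: le_trans; exact: ler_coord_norm.
have gjc x : `|x - a| <= `|b - a| -> {for x, continuous gj}.
  move=> /gj' ?; apply/differentiable_continuous/derivable1_diffP; exact: ex_derive.
have gjw (i : interval R) : {in i, forall x, `|x - a| <= `|b - a|} ->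
   {within [set` i], continuous gj}.
  move=> ih; apply: derivable_within_continuous => x /ih /gj' ?; exact: ex_derive.
rewrite !mxE.
have [ab|/ltW ba] := leP a b.
  have ih x : x \in `[a, b] -> `|x - a| <= `|b - a|.
    by rewrite in_itv/= => /andP[ax xb]; rewrite !ger0_norm ?subr_ge0// lerB.
  have [||c cab ->] := @MVT_segment R gj (fun x => derive1 g x 0 j) a b ab.
  - by move=> x /subset_itv_oo_cc/ih /gj'.
  - by apply: gjw => x; exact: ih.
  by rewrite normrM ler_wpM2r// gjC// ih.
have ih x : x \in `[b, a] -> `|x - a| <= `|b - a|.
  rewrite in_itv/= => /andP[ax xb]; rewrite ![`|_ - a|]distrC !ger0_norm ?subr_ge0//.
  by rewrite lerB.
have [||c cab E] := @MVT_segment R gj (fun x => derive1 g x 0 j) b a ba.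
- by move=> x /subset_itv_oo_cc/ih /gj'.
- by apply: gjw => x; exact: ih.
by rewrite distrC E normrM [`|b - a|]distrC ler_wpM2r// gjC// ih.
Qed.

End row_vectors.

(** * Smooth functions along a solution *)

Section scaling.
Context {R : realType} {V W : normedModType R}.

(** Scaling is packed as a bilinear map, so that the product rule below is the differential of a
    continuous bilinear map composed with a pairing. *)
Let scale_bilinear :
  bilinear_for
    (GRing.Scale.Law.clone _ _ *:%R _) (GRing.Scale.Law.clone _ _ *:%R _)
    (@GRing.scale R W : R -> W -> W).
Proof.
split=> [u'|u] a x y /=; first by rewrite scalerDl scalerA.
by rewrite scalerDr !scalerA mulrC.
Qed.
Let B : {bilinear R -> W -> W} :=
  HB.pack (@GRing.scale R W : R -> W -> W)
   (bilinear_isBilinear.Build R R W W _ _ (@GRing.scale R W : R -> W -> W) scale_bilinear).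

Let B_continuous : continuous (fun p : R * W => B p.1 p.2).
Proof. exact: scale_continuous. Qed.

Variables (a : V -> R) (g : V -> W) (x : V).
Hypotheses (da : differentiable a x) (dg : differentiable g x).

Let scale_comp : (fun z => a z *: g z) = (fun p : R * W => B p.1 p.2) \o (fun z => (a z, g z)).
Proof. by []. Qed.

Lemma differentiable_scale : differentiable (fun z => a z *: g z) x.
Proof.
rewrite scale_comp; apply: differentiable_comp; first exact: differentiable_pair.
exact: differentiable_bilin.
Qed.

Lemma derive_scale v :
  'D_v (fun z => a z *: g z) x = a x *: 'D_v g x + 'D_v a x *: g x.
Proof.
rewrite deriveE; last exact: differentiable_scale.
rewrite scale_comp diff_comp; last 2 first.
  exact: differentiable_pair.
  exact: differentiable_bilin.
have E := congr1 (@^~ ('d (fun z => (a z, g z)) x v))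
  (@diff_bilin _ _ _ _ B (a x, g x) B_continuous).
by apply: etrans E _; rewrite diff_pair// !deriveE.
Qed.

End scaling.

Section Ck_closure.
Context {R : realType}.
Implicit Types (V W : normedModType R) (k : nat).

Lemma CkW V W k (f : V -> W) : Ck k.+1 f -> Ck k f.
Proof.
elim: k f => [|k IH] f /= [df Df]; first by move=> x; exact: differentiable_continuous.
by split=> // v; exact/IH/Df.
Qed.

Lemma Ck_ext V W k (f g : V -> W) : f =1 g -> Ck k g -> Ck k f.
Proof. by move=> /funext ->. Qed.

Lemma Ck_cst V W k (w : W) : Ck k (fun _ : V => w).
Proof.
elim: k w => [|k IH] w /=; first exact: cst_continuous.
split=> [x|v]; first exact: differentiable_cst.
by apply: (Ck_ext _ (IH 0)) => x; rewrite derive_cst.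
Qed.

Lemma CkD V W k (f g : V -> W) : Ck k f -> Ck k g -> Ck k (fun x => f x + g x).
Proof.
elim: k f g => [|k IH] f g /=.
  by move=> cf cg x; apply: continuousD; [exact: cf|exact: cg].
move=> [df Df] [dg Dg]; split=> [x|v]; first exact: differentiableD.
apply: (Ck_ext _ (IH _ _ (Df v) (Dg v))) => x.
by rewrite deriveD//; exact: diff_derivable.
Qed.

Lemma Ck_sum V W k (I : Type) (r : seq I) (P : pred I) (f : I -> V -> W) :
  (forall i, P i -> Ck k (f i)) -> Ck k (fun x => \sum_(i <- r | P i) f i x).
Proof.
move=> H; elim: r => [|i r IH].
  by apply: (Ck_ext _ (Ck_cst V k 0)) => x; rewrite big_nil.
apply: (@Ck_ext _ _ _ _
    (fun x => (if P i then f i x else 0) + \sum_(j <- r | P j) f j x)).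
  by move=> x; rewrite big_cons; case: ifP; rewrite ?add0r.
by apply: CkD => //; have := H i; case: (P i) => [|_]; [exact|exact: Ck_cst].
Qed.

(** The product rule yields products of one derivative and one undifferentiated factor; [CkW] lowers
    the latter to the class of the induction hypothesis. *)
Lemma Ck_scale V W k (a : V -> R) (g : V -> W) :
  Ck k a -> Ck k g -> Ck k (fun x => a x *: g x).
Proof.
elim: k a g => [|k IH] a g /=.
  by move=> ca cg x; apply: continuousZ; [exact: ca|exact: cg].
move=> Ca Cg; have [[da Da] [dg Dg]] := (Ca, Cg).
split=> [x|v]; first exact: differentiable_scale.
apply: (@Ck_ext _ _ _ _ (fun x => a x *: 'D_v g x + 'D_v a x *: g x)).
  by move=> x; rewrite derive_scale.
by apply: CkD; apply: IH => //; exact: CkW.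
Qed.

Lemma Ck_coord V d k (f : V -> 'rV[R]_d) i : Ck k f -> Ck k (fun x => f x 0 i).
Proof.
elim: k f => [|k IH] f /=.
  move=> cf x; apply: (@continuous_comp _ _ _ f (fun M : 'rV[R]_d => M 0 i)).
    exact: cf.
  exact: coord_continuous.
move=> [df Df]; split=> [x|v].
  apply: (@differentiable_comp _ _ _ _ f (fun M : 'rV[R]_d => M 0 i)) => //.
  exact: differentiable_coord.
apply: (Ck_ext _ (IH _ (Df v))) => x.
by rewrite derive_mx ?mxE//; exact: diff_derivable.
Qed.

Lemma Ck_coord_id d k i : Ck k (fun x : 'rV[R]_d => x 0 i).
Proof.
apply: (@Ck_coord _ d k id); case: k => [|k] /=; first by move=> x.
split=> [x|v]; first exact: ex_diff.
by apply: (Ck_ext _ (Ck_cst _ k v)) => x; rewrite derive_id.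
Qed.

Lemma Ck_exp V k (a : V -> R) n : Ck k a -> Ck k (fun x => a x ^+ n).
Proof.
move=> Ca; elim: n => [|n IH].
  by apply: (Ck_ext _ (Ck_cst V k (1 : R))) => x; rewrite expr0.
by apply: (Ck_ext _ (Ck_scale Ca IH)) => x; rewrite exprS.
Qed.

Lemma smooth_differentiable V W (f : V -> W) x : smooth f -> differentiable f x.
Proof. by move=> /(_ 1%N)[]. Qed.

Lemma smooth_derive V W (f : V -> W) v : smooth f -> smooth (fun x => 'D_v f x).
Proof. by move=> sf k; have [_] := sf k.+1; exact. Qed.

End Ck_closure.

Section Lie_derivative.
Context {R : realType} {d : nat} {W : normedModType R}.
Implicit Types (F : 'rV[R]_d -> 'rV[R]_d) (g : 'rV[R]_d -> W) (y : R -> 'rV[R]_d).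

Lemma derive_coords g x v : differentiable g x ->
  'D_v g x = \sum_i v 0 i *: 'D_(delta_mx 0 i) g x.
Proof.
move=> dg; rewrite deriveE// [in LHS](row_sum_delta v) linear_sum.
by apply: eq_bigr => i _; rewrite linearZ deriveE.
Qed.

(** The direction [F x] varies with [x], while [Ck] speaks of fixed directions; the derivative is
    therefore expanded over the coordinate directions. *)
Lemma smooth_Lie F g : smooth F -> smooth g -> smooth (fun x => 'D_(F x) g x).
Proof.
move=> sF sg k.
apply: (@Ck_ext _ _ _ _ _ (fun x => \sum_i F x 0 i *: 'D_(delta_mx 0 i) g x)).
  by move=> x; rewrite -derive_coords//; exact: smooth_differentiable.
apply: Ck_sum => i _; apply: Ck_scale; first exact: Ck_coord.
exact: smooth_derive.
Qed.

Lemma is_derive_along F g y u : differentiable g (y u) ->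
  is_derive u (1 : R) y (F (y u)) ->
  is_derive u (1 : R) (g \o y) ('D_(F (y u)) g (y u)).
Proof.
move=> dg [dy Dy].
have dy' : differentiable y u by exact/derivable1_diffP.
have dgy : differentiable (g \o y) u by exact: differentiable_comp.
apply: DeriveDef; first exact: diff_derivable.
by rewrite deriveE// diff_comp//= deriveE// -Dy deriveE.
Qed.

Lemma near_derive1n (f1 f2 : R -> W) (t : R) n :
  (\forall u \near t, f1 u = f2 u) ->
  \forall u \near t, derive1n n f1 u = derive1n n f2 u.
Proof.
elim: n f1 f2 => // n IH f1 f2 H; rewrite !derive1Sn; apply: IH.
(* Equality at [u] alone does not determine the derivative; the interior provides equality on a
   neighbourhood of each nearby [u]. *)
have := nbhs_interior H; apply: filterS => u Hu.
by rewrite !derive1E; apply: near_eq_derive.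
Qed.

(** Differentiating along the solution replaces [g] by its Lie derivative, which is smooth again.
    Hence all higher derivatives exist near [t], although [solves_near] only provides the first
    derivative of [y]. *)
Lemma derive1n_along F g y t n : smooth F -> smooth g -> solves_near F y t ->
  exists2 G : 'rV[R]_d -> W, smooth G &
    \forall u \near t, derive1n n (g \o y) u = G (y u).
Proof.
move=> sF + sol; elim: n g => [|n IH] g sg; first by exists g => //; near=> u.
have [G sG HG] := IH _ (smooth_Lie sF sg).
exists G => //; rewrite derive1Sn.
have H : \forall u \near t, derive1 (g \o y) u = ((fun x => 'D_(F x) g x) \o y) u.
  apply: filterS sol => u yu; rewrite derive1E.
  have [_ ->//] := is_derive_along (smooth_differentiable (y u) sg) yu.
by have := near_derive1n n H; apply: filterS2 HG => u <-.
Unshelve. all: by end_near. Qed.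

Lemma derivable_along F g y t n : smooth F -> smooth g -> solves_near F y t ->
  \forall u \near t, derivable (derive1n n (g \o y)) u 1.
Proof.
move=> sF sg sol; have [G sG HG] := derive1n_along n sF sg sol.
have := nbhs_interior HG; apply: filterS2 sol => u yu Hu.
have [H _] := is_derive_along (smooth_differentiable (y u) sG) yu.
apply: near_eq_derivable H; apply: filterS Hu => v -> //.
Qed.

End Lie_derivative.

(** * Taylor expansion and local Lipschitz bounds *)

Section Taylor.
Context {R : realType}.

Lemma is_derive_translate (W : normedModType R) (g : R -> W) (t z : R) :
  derivable g (t + z) 1 ->
  is_derive z (1 : R) (fun x => g (t + x)) (derive1 g (t + z)).
Proof.
have E : (fun h : R => h^-1 *: (g (t + (h *: (1 : R) + z)) - g (t + z))) =
    (fun h : R => h^-1 *: (g (h *: (1 : R) + (t + z)) - g (t + z))).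
  by apply/funext => h; rewrite addrCA.
move=> dg; apply: DeriveDef; first by rewrite /derivable E.
by rewrite derive1E /derive E.
Qed.

Lemma is_derive_expZ (W : normedModType R) (v : W) k (z : R) :
  is_derive z (1 : R) (fun x => x ^+ k *: v) ((k%:R * z ^+ k.-1) *: v).
Proof.
have dz : differentiable (fun x : R => x ^+ k : R) z.
  by apply/derivable1_diffP; exact: exprn_derivable.
have dv : differentiable (cst v) z by exact: differentiable_cst.
apply: DeriveDef.
  exact: diff_derivable (@differentiable_scale _ _ _ _ (cst v) z dz dv).
rewrite (@derive_scale _ _ _ _ (cst v) z dz dv) derive_cst scaler0 add0r.
by rewrite exp_derive [_ *: 1]mulr1.
Qed.

Lemma is_derive_monomial (W : normedModType R) (v : W) k (z : R) :
  is_derive z (1 : R) (fun x => (x ^+ k.+1 / k.+1`!%:R) *: v)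
    ((z ^+ k / k`!%:R) *: v).
Proof.
rewrite (_ : (fun x => _) = fun x : R => x ^+ k.+1 *: (k.+1`!%:R^-1 *: v)).
  apply: is_derive_eq (is_derive_expZ _ _ _) _.
  rewrite scalerA factS natrM; congr (_ *: _); field.
  by rewrite pnatr_eq0 -lt0n fact_gt0 addrC natr1 pnatr_eq0.
by apply/funext => x; rewrite scalerA.
Qed.

Lemma is_derive_taylor_poly (W : normedModType R) (v : nat -> W) n (z : R) :
  is_derive z (1 : R) (fun x => \sum_(k < n.+1) (x ^+ k / k`!%:R) *: v k)
    (\sum_(k < n) (z ^+ k / k`!%:R) *: v k.+1).
Proof.
elim: n => [|n IH].
  rewrite big_ord0 (_ : (fun x => _) = cst (v 0%N)); first exact: is_derive_cst.
  by apply/funext => x; rewrite big_ord1 expr0 fact0 divr1 scale1r.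
rewrite (_ : (fun x => _) = (fun x => \sum_(k < n.+1) (x ^+ k / k`!%:R) *: v k)
    + (fun x => (x ^+ n.+1 / n.+1`!%:R) *: v n.+1)).
  rewrite big_ord_recr; apply: is_deriveD; exact: is_derive_monomial.
by apply/funext => x; rewrite big_ord_recr.
Qed.

(** Induction through the derivative: the remainder [r] vanishes at 0 and its derivative is the
    remainder of [derive1 g] with one term less, so the mean value inequality gains one factor
    [|x|]. *)
Lemma taylor d (g : R -> 'rV[R]_d) (t : R) n :
  (forall k, \forall u \near t, derivable (derive1n k g) u 1) ->
  exists C, \forall x \near (0 : R),
    `|g (t + x) - \sum_(k < n) (x ^+ k / k`!%:R) *: derive1n k g t|
      <= C * `|x| ^+ n.
Proof.
elim: n g => [|n IH] g dg.
  exists (`|g t| + 1).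
  have cg : (fun x => g (t + x)) x @[x --> 0] --> g (t + 0).
    apply/differentiable_continuous/derivable1_diffP.
    apply: (@ex_derive _ _ _ _ _ _ (derive1 g (t + 0))).
    apply: is_derive_translate; rewrite addr0; exact: nbhs_singleton (dg 0%N).
  move/cvgrPdist_le: cg => /(_ 1 ltr01); apply: filterS => x.
  rewrite addr0 big_ord0 subr0 expr0 mulr1 => H.
  by rewrite -[g (t + x)](subrK (g t)) addrC (le_trans (ler_normD _ _))// lerD2l distrC.
have [C HC] : exists C, \forall x \near (0 : R),
    `|derive1 g (t + x) - \sum_(k < n) (x ^+ k / k`!%:R) *: derive1n k.+1 g t|
      <= C * `|x| ^+ n.
  have [|C HC] := IH (derive1 g); first by move=> k; rewrite -derive1Sn.
  exists C; apply: filterS HC => x; congr (`|_ - _| <= _).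
  by apply: eq_bigr => k _; rewrite derive1Sn.
exists `|C|.
have /nbhs_ballP[e1 /= e10 H1] := dg 0%N.
have /nbhs_ballP[e2 /= e20 H2] := HC.
apply/nbhs_ballP; exists (Num.min e1 e2); first by rewrite /= lt_min e10.
move=> x /=; rewrite /ball/= sub0r normrN lt_min => /andP[xe1 xe2].
pose r x := g (t + x) - \sum_(k < n.+1) (x ^+ k / k`!%:R) *: derive1n k g t.
have r0 : r 0 = 0.
  rewrite /r big_ord_recl big1 ?addr0 ?expr0 ?fact0 ?divr1 ?scale1r ?subrr//.
  by move=> i _; rewrite /= exprS mul0r mul0r scale0r.
have -> : `|C| * `|x| ^+ n.+1 = (`|C| * `|x| ^+ n) * `|x - 0|.
  by rewrite subr0 exprSr mulrA.
rewrite -[X in `|X|]/(r x) -[r x]subr0 -r0; apply: mean_value_ineq => z.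
rewrite !subr0 => zx.
have dr : is_derive z (1 : R) r (derive1 g (t + z)
     - \sum_(k < n) (z ^+ k / k`!%:R) *: derive1n k.+1 g t).
  apply: is_deriveB; last exact: (is_derive_taylor_poly (fun k => derive1n k g t)).
  apply: is_derive_translate; apply: H1.
  by rewrite /ball/= opprD addrA subrr sub0r normrN (le_lt_trans zx).
split; first exact: ex_derive.
rewrite derive1E derive_val; apply: le_trans (_ : C * `|z| ^+ n <= _).
  by apply: H2; rewrite /ball/= sub0r normrN (le_lt_trans zx).
apply: le_trans (_ : `|C| * `|z| ^+ n <= _).
  by rewrite ler_wpM2r ?exprn_ge0 ?ler_norm.
by rewrite ler_wpM2l// lerXn2r ?nnegrE.
Qed.

End Taylor.

Lemma smooth_lipschitz (R : realType) (d : nat) (f : 'rV[R]_d -> 'rV[R]_d)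
    (M : R) : smooth f ->
  exists2 L, 0 <= L & forall x y, `|x| <= M -> `|y| <= M ->
    `|f x - f y| <= L * `|x - y|.
Proof.
move=> sf.
(* The mean value inequality on [[0, 1]] asks for bounds at all [|s| <= 1], negative [s] included;
   there [y + s *: (x - y)] has norm at most [M + (M + M)]. *)
pose A := [set v : 'rV[R]_d | `|v| <= M + (M + M)].
have cA : compact A.
  apply: bounded_closed_compact.
    exists (M + (M + M)); split=> [|u Mu v /= /le_trans]; first exact: num_real.
    by apply; exact: ltW.
  apply: (@preimage_closed _ _ (fun v : 'rV[R]_d => `|v|) [set z | z <= M + (M + M)]).
    by move=> v _; exact: norm_continuous.
  exact: closed_le.
have bA i : exists C, forall v, A v -> `|'D_(delta_mx 0 i) f v| <= C.
  have : bounded_set ((fun v => 'D_(delta_mx 0 i) f v) @` A).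
    apply: compact_bounded; apply: continuous_compact => //.
    apply: continuous_subspaceT; exact: (smooth_derive (delta_mx 0 i) sf 0%N).
  move=> [C [_ HC]]; exists (C + 1) => v Av; apply: (HC (C + 1)); last by exists v.
  by rewrite ltrDl.
have /choice[C HC] := bA.
exists (\sum_i `|C i|); first exact: sumr_ge0.
move=> x y xM yM.
pose l (s : R) := y + s *: (x - y).
have dl s : is_derive s (1 : R) l (x - y).
  have D : is_derive s (1 : R) ( *:%R ^~ (x - y)) (x - y).
    by apply: DeriveDef; rewrite ?deriveE ?diff_val ?scale1r//; exact: diff_derivable.
  by have := is_deriveD (is_derive_cst y s (1 : R)) D; rewrite add0r.
have dfl s : is_derive s (1 : R) (f \o l) ('D_(x - y) f (l s)).
  apply: (@is_derive_along _ _ _ (fun=> x - y)).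
    exact: smooth_differentiable.
have -> : f x = (f \o l) 1 by rewrite /= /l scale1r addrC subrK.
have -> : f y = (f \o l) 0 by rewrite /= /l scale0r addr0.
rewrite -[leRHS]mulr1 -[X in _ * X](@normr1 R) -[X in _ * `|X|](subr0 1).
apply: mean_value_ineq => s; rewrite !subr0 normr1 => s1.
split; first exact: ex_derive.
rewrite derive1E derive_val derive_coords; last exact: smooth_differentiable.
rewrite mulr_suml; apply: le_trans (ler_norm_sum _ _ _) _.
apply: ler_sum => i _; rewrite normrZ mulrC ler_pM//.
  apply: le_trans (HC _ _ _) (ler_norm _); rewrite /A/=.
  apply: le_trans (ler_normD _ _) _; rewrite lerD// normrZ.
  apply: le_trans (_ : 1 * `|x - y| <= _); first by rewrite ler_wpM2r.
  by rewrite mul1r (le_trans (ler_normB _ _))// lerD.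
exact: ler_coord_norm.
Qed.

(** * Expansions in the step size *)

Section expansions.
Context {R : realType} {V : normedModType R} {N : nat}.
Variables (p : nat) (y0 : V) (D : 'I_N -> nat -> V).
Implicit Types (sigma : 'I_N) (b : nat -> R) (beta : 'I_N -> nat -> R)
  (alpha a : R) (g : R -> V).

(** [D sigma k] will be the derivative of order [k - 1] of [f sigma] along the solution; hence the
    sum starts at 1 and [b 0] is never read. *)
Definition partition_sum sigma b (h : R) : V :=
  \sum_(1 <= k < p.+1) (b k * h ^+ k) *: D sigma k.

Definition expansion alpha beta (h : R) : V :=
  alpha *: y0 + \sum_sigma partition_sum sigma (beta sigma) h.

Definition partition_expands sigma g b : Prop :=
  Oh p.+1 (fun h => g h - partition_sum sigma b h).

Definition expands g alpha beta : Prop :=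
  Oh p.+1 (fun h => g h - expansion alpha beta h).

Lemma partition_expands_sum sigma (I : Type) (r : seq I) (g : I -> R -> V)
    (a : I -> R) (b : I -> nat -> R) :
  (forall i, partition_expands sigma (g i) (b i)) ->
  partition_expands sigma (fun h => \sum_(i <- r) a i *: g i h)
    (fun k => \sum_(i <- r) a i * b i k).
Proof.
move=> H; apply: Oh_near (Oh_sum r (P := xpredT) (fun i _ => OhZ (a i) (H i))).
near=> h; under eq_bigr do rewrite scalerBr; rewrite sumrB; congr (_ - _).
rewrite /partition_sum; under eq_bigr do rewrite scaler_sumr.
rewrite exchange_big/=; apply: eq_bigr => k _; rewrite mulr_suml scaler_suml.
by apply: eq_bigr => i _; rewrite scalerA mulrA.
Unshelve. all: by end_near. Qed.

Lemma expands_parts (g : 'I_N -> R -> V) beta :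
  (forall sigma, partition_expands sigma (g sigma) (beta sigma)) ->
  expands (fun h => \sum_sigma g sigma h) 0 beta.
Proof.
move=> H; apply: Oh_near (Oh_sum (index_enum _) (P := xpredT) (fun s _ => H s)).
by near=> h; rewrite sumrB /expansion scale0r add0r.
Unshelve. all: by end_near. Qed.

Lemma partition_sumD sigma b1 b2 h :
  partition_sum sigma (fun k => b1 k + b2 k) h
  = partition_sum sigma b1 h + partition_sum sigma b2 h.
Proof.
by rewrite /partition_sum -big_split/=; apply: eq_bigr => k _; rewrite mulrDl scalerDl.
Qed.

Lemma partition_sumZ sigma a b h :
  partition_sum sigma (fun k => a * b k) h = a *: partition_sum sigma b h.
Proof.
rewrite /partition_sum scaler_sumr.
by apply: eq_bigr => k _; rewrite scalerA mulrA.
Qed.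

Lemma expandsD g1 g2 alpha1 alpha2 beta1 beta2 :
  expands g1 alpha1 beta1 -> expands g2 alpha2 beta2 ->
  expands (fun h => g1 h + g2 h) (alpha1 + alpha2)
    (fun sigma k => beta1 sigma k + beta2 sigma k).
Proof.
move=> H1 H2; apply: Oh_near (OhD H1 H2); near=> h.
rewrite /expansion scalerDl; under [in RHS]eq_bigr do rewrite partition_sumD.
by rewrite big_split/= addrACA -opprD; congr (_ - _); rewrite addrACA.
Unshelve. all: by end_near. Qed.

Lemma expandsZ g a alpha beta : expands g alpha beta ->
  expands (fun h => a *: g h) (a * alpha) (fun sigma k => a * beta sigma k).
Proof.
move=> H; apply: Oh_near (OhZ a H); near=> h.
rewrite /expansion scalerBr scalerDr scalerA scaler_sumr.
by congr (_ - (_ + _)); apply: eq_bigr => sigma _; rewrite partition_sumZ.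
Unshelve. all: by end_near. Qed.

Lemma expands_ext g1 g2 alpha1 alpha2 beta1 beta2 :
  (\forall h \near 0^'+, g1 h = g2 h) -> alpha1 = alpha2 ->
  (forall sigma k, (1 <= k < p.+1)%N -> beta1 sigma k = beta2 sigma k) ->
  expands g1 alpha1 beta1 -> expands g2 alpha2 beta2.
Proof.
move=> Hg <- Hb; apply: Oh_near; near=> h; congr (_ - (_ + _)); first by near: h.
apply: eq_bigr => sigma _; apply: eq_big_nat => k kp.
by rewrite Hb.
Unshelve. all: by end_near. Qed.

Lemma expands0 : expands (fun=> 0) 0 (fun _ _ => 0).
Proof.
apply: Oh_near (Oh0 _); near=> h.
rewrite /expansion scale0r !add0r big1 ?oppr0// => sigma _.
by rewrite /partition_sum big1// => k _; rewrite mul0r scale0r.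
Unshelve. all: by end_near. Qed.

Lemma expands_sum (I : Type) (r : seq I) (g : I -> R -> V)
    (a alpha : I -> R) (beta : I -> 'I_N -> nat -> R) :
  (forall i, expands (g i) (alpha i) (beta i)) ->
  expands (fun h => \sum_(i <- r) a i *: g i h) (\sum_(i <- r) a i * alpha i)
    (fun sigma k => \sum_(i <- r) a i * beta i sigma k).
Proof.
move=> H; elim: r => [|i r IH].
  apply: expands_ext expands0; first by near=> h; rewrite big_nil.
    by rewrite big_nil.
  by move=> *; rewrite big_nil.
apply: expands_ext (expandsD (expandsZ (a i) (H i)) IH).
- by near=> h; rewrite big_cons.
- by rewrite big_cons.
- by move=> *; rewrite big_cons.
Unshelve. all: by end_near. Qed.

Lemma expandsB g1 g2 alpha1 alpha2 beta1 beta2 :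
  expands g1 alpha1 beta1 -> expands g2 alpha2 beta2 ->
  expands (fun h => g1 h - g2 h) (alpha1 - alpha2)
    (fun sigma k => beta1 sigma k - beta2 sigma k).
Proof.
move=> H1 H2; have := expandsD H1 (expandsZ (-1) H2); apply: expands_ext.
- by near=> h; rewrite scaleN1r.
- by rewrite mulN1r.
- by move=> *; rewrite mulN1r.
Unshelve. all: by end_near. Qed.

(** The surviving terms have [k > q] and are constants times [h ^+ k]; the remainder of order
    [p + 1] is small enough because [q <= p]. *)
Lemma expands_Oh g alpha beta q : (q <= p)%N -> expands g alpha beta ->
  alpha = 0 ->
  (forall sigma k, (1 <= k < q.+1)%N -> beta sigma k = 0) ->
  Oh q.+1 g.
Proof.
move=> qp + a0 b0; rewrite a0 => H.
have E : Oh q.+1 (fun h => expansion 0 beta h).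
  apply: (@Oh_near _ _ _ (fun h => \sum_sigma partition_sum sigma (beta sigma) h)).
    by near=> h; rewrite /expansion scale0r add0r.
  apply: Oh_sum => sigma _.
  (* The range is repeated as a filter so that [Oh_sum] hands over the bounds on [k]. *)
  apply: (@Oh_near _ _ _ (fun h =>
    \sum_(k <- index_iota 1 p.+1 | k \in index_iota 1 p.+1)
      (beta sigma k * h ^+ k) *: D sigma k)); first by near=> h; rewrite -big_seq.
  apply: Oh_sum => k; rewrite mem_index_iota => /andP[k1 kp].
  have [kq|qk] := leqP k q.
    apply: Oh_near (Oh0 _); near=> h.
    by rewrite b0 ?k1// mul0r scale0r.
  apply: Oh_near (OhZ (beta sigma k) (Oh_monomial (D sigma k) qk)).
  by near=> h; rewrite scalerA.
have := OhD (Oh_le (_ : (q.+1 <= p.+1)%N) H) E; rewrite ltnS => /(_ qp).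
by apply: Oh_near; near=> h; rewrite subrK.
Unshelve. all: by end_near. Qed.

End expansions.

(** * Expansions along the exact solution *)

Section along_solution.
Context {R : realType} {N d : nat}.
Variables (p : nat) (f : 'I_N -> 'rV[R]_d -> 'rV[R]_d) (y : R -> 'rV[R]_d) (t : R).
Hypothesis f_smooth : forall sigma, smooth (f sigma).
Hypothesis y_sol : solves_near (fun x => \sum_sigma f sigma x) y t.

Let phi sigma := fun u => f sigma (y u).
Let D sigma k := derive1n k.-1 (phi sigma) t.

Lemma smooth_sum : smooth (fun x => \sum_sigma f sigma x).
Proof. by move=> k; apply: Ck_sum => sigma _; exact: f_smooth. Qed.

Lemma phi_derivable sigma k :
  \forall u \near t, derivable (derive1n k (phi sigma)) u 1.
Proof. exact: (derivable_along k smooth_sum (f_smooth sigma) y_sol). Qed.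

Lemma derive1n_sum n :
  \forall u \near t, derive1n n (fun v => \sum_sigma phi sigma v) u =
    \sum_sigma derive1n n (phi sigma) u.
Proof.
elim: n => [|n IH]; first by near=> u.
have H : \forall u \near t, forall sigma, derivable (derive1n n (phi sigma)) u 1.
  apply: (@filter_forall _ _ (fun sigma u =>
    derivable (derive1n n (phi sigma)) u 1) (nbhs t) (nbhs_filter t)).
  by move=> sigma; exact: phi_derivable.
have := nbhs_interior IH; apply: filterS2 H => u Hu Iu.
rewrite derive1nS derive1E (near_eq_derive _ Iu).
have -> : (fun a => \sum_sigma derive1n n (phi sigma) a) =
    \sum_sigma derive1n n (phi sigma) by apply/funext => a; rewrite fct_sumE.
by rewrite derive_sum//; apply: eq_bigr => sigma _; rewrite -derive1E.
Unshelve. all: by end_near. Qed.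

Lemma derive1n_sol n :
  \forall u \near t, derive1n n.+1 y u = \sum_sigma derive1n n (phi sigma) u.
Proof.
have H : \forall u \near t, derive1 y u = \sum_sigma phi sigma u.
  by apply: filterS y_sol => u [_ yu]; rewrite derive1E.
have := near_derive1n n H; rewrite -derive1Sn => H1.
by apply: filterS2 H1 (derive1n_sum n) => u ->.
Qed.

Lemma sol_derivable k : \forall u \near t, derivable (derive1n k y) u 1.
Proof.
case: k => [|k]; first by apply: filterS y_sol => u [].
have H : \forall u \near t, forall sigma, derivable (derive1n k (phi sigma)) u 1.
  apply: (@filter_forall _ _ (fun sigma u =>
    derivable (derive1n k (phi sigma)) u 1) (nbhs t) (nbhs_filter t)).
  by move=> sigma; exact: phi_derivable.
have := nbhs_interior (derive1n_sol k); apply: filterS2 H => u Hu Iu.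
apply: near_eq_derivable (derivable_sum Hu).
by apply: filterS Iu => v ->; rewrite fct_sumE.
Qed.

Lemma Oh_taylor (g : R -> 'rV[R]_d) (c : R) n :
  (forall k, \forall u \near t, derivable (derive1n k g) u 1) ->
  Oh n (fun h => g (t + c * h) -
    \sum_(k < n) ((c * h) ^+ k / k`!%:R) *: derive1n k g t).
Proof.
move=> dg; have [C HC] := taylor n dg.
apply/OhP; exists (C * `|c| ^+ n).
(* An abscissa may be negative or zero, which is why the Taylor bound is stated on a full
   neighbourhood of 0. *)
have ch : (c * h) @[h --> 0^'+] --> (0 : R).
  rewrite -[X in _ --> X](mulr0 c).
  apply: cvg_at_right_filter; exact: (@mulrl_continuous R c 0).
near=> h; have h0 : 0 < h by near: h; exact: nbhs_right_gt.
rewrite -mulrA -[h in leRHS]gtr0_norm// -exprMn -normrM.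
near: h; exact: ch HC.
Unshelve. all: by end_near. Qed.

Lemma sol_Oh0 c : Oh 0 (fun h => y (t + c * h)).
Proof.
apply: Oh_near (Oh_taylor c 0 sol_derivable).
by near=> h; rewrite big_ord0 subr0.
Unshelve. all: by end_near. Qed.

(** The factor [h] shifts the index: the coefficient at [k] is the Taylor coefficient of index
    [k - 1]. *)
Lemma stage_expands sigma c :
  partition_expands p D sigma (fun h => h *: phi sigma (t + c * h))
    (fun k => c ^+ k.-1 / k.-1`!%:R).
Proof.
have := Oh_shift 1 (Oh_taylor c p (phi_derivable sigma)).
rewrite add1n; apply: Oh_near; near=> h.
rewrite expr1 scalerBr; congr (_ - _).
rewrite /partition_sum big_add1/= big_mkord scaler_sumr; apply: eq_bigr => k _ /=.
by rewrite scalerA exprMn exprS; congr (_ *: _); ring.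
Unshelve. all: by end_near. Qed.

(** The prefactor [h ^+ k] leaves a Taylor expansion with [p - k + 1] terms to be made; its term of
    index [j] contributes at [m = k + j], with coefficient [1 / (m - k)!]. *)
Lemma external_partition_expands sigma k : (1 <= k < p.+1)%N ->
  partition_expands p D sigma (fun h => h ^+ k *: derive1n k.-1 (phi sigma) (t + h))
    (fun m => if (k <= m)%N then (m - k)`!%:R^-1 else 0).
Proof.
case: k => // k /andP[_]; rewrite ltnS /= => kp.
have dk j : \forall u \near t, derivable (derive1n j (derive1n k (phi sigma))) u 1.
  by rewrite /derive1n -iterD; exact: phi_derivable.
have := Oh_shift k.+1 (Oh_taylor 1 (p - k) dk).
rewrite addSn subnKC ?(ltnW kp)//; apply: Oh_near; near=> h.
rewrite mul1r scalerBr; congr (_ - _).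
rewrite /partition_sum (big_cat_nat (n := k.+1))//=; last by rewrite ltnS (ltnW kp).
rewrite [X in _ = X + _]big_nat [X in _ = X + _]big1 ?add0r; last first.
  by move=> m /andP[_ mk]; rewrite leqNgt mk mul0r scale0r.
rewrite -[X in \sum_(X <= _ < _) _]add0n big_addn subSS big_mkord scaler_sumr.
apply: eq_bigr => m _; rewrite leq_addl addnK scalerA.
have -> : D sigma (m + k.+1) = derive1n m (derive1n k (phi sigma)) t.
  by rewrite /D addnS /derive1n -iterD.
by congr (_ *: _); rewrite exprD [LHS]mulrC -mulrA mulrCA.
Unshelve. all: by end_near. Qed.

(** The coefficients are the same for all partitions because each derivative of [y] is the plain sum
    of the derivatives of the [f sigma] along [y]. *)
Lemma sol_expands c :
  expands p (y t) D (fun h => y (t + c * h)) 1 (fun _ k => c ^+ k / k`!%:R).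
Proof.
have := Oh_taylor c p.+1 sol_derivable; apply: Oh_near; near=> h; congr (_ - _).
rewrite big_ord_recl expr0 fact0 divr1; congr (_ + _).
rewrite /partition_sum exchange_big/= big_add1/= big_mkord; apply: eq_bigr => k _.
rewrite /bump add1n -derive1nS add0n (nbhs_singleton (derive1n_sol k)) scaler_sumr.
by apply: eq_bigr => sigma _; rewrite exprMn mulrAC.
Unshelve. all: by end_near. Qed.

Lemma external_expands (w0 : R) (w : 'I_N -> nat -> R) :
  expands p (y t) D
    (fun h => expansion p (y (t + h))
       (fun sigma k => derive1n k.-1 (phi sigma) (t + h)) w0 w h)
    w0 (fun sigma m => w0 / m`!%:R + \sum_(1 <= k < p.+1)
          w sigma k * (if (k <= m)%N then (m - k)`!%:R^-1 else 0)).
Proof.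
have H1 := expandsZ w0 (sol_expands 1).
have H2 sigma : partition_expands p D sigma
   (fun h => \sum_(1 <= k < p.+1)
      (* The guard makes the summand expand for every [k], as [partition_expands_sum] demands; it is
         removed again at the end. *)
      w sigma k *: (if (1 <= k < p.+1)%N
        then h ^+ k *: derive1n k.-1 (phi sigma) (t + h) else 0))
   (fun m => \sum_(1 <= k < p.+1)
      w sigma k * (if (1 <= k < p.+1)%N
        then if (k <= m)%N then (m - k)`!%:R^-1 else 0 else 0)).
  apply: partition_expands_sum => k; have := @external_partition_expands sigma k.
  case: (1 <= k < p.+1)%N => [H|_]; first exact: H.
  apply: Oh_near (Oh0 _); near=> h.
  by rewrite /partition_sum big1 ?subr0// => j _; rewrite mul0r scale0r.
apply: expands_ext (expandsD H1 (expands_parts (y t) H2)).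
- near=> h; rewrite mul1r /expansion; congr (_ + _).
  apply: eq_bigr => sigma _; apply: eq_big_nat => k ->.
  by rewrite scalerA.
- by rewrite mulr1 addr0.
- move=> sigma k _; rewrite expr1n mul1r; congr (_ + _).
  by apply: eq_big_nat => l ->.
Unshelve. all: by end_near. Qed.

(** Right-hand side of a step with the exact solution in place of the stages. It serves the stages,
    with rows of [A] and [U], and the outputs, with rows of [B] and [V]. *)
Lemma rhs_expands (s r : nat) (c : 'I_s -> R) (a : 'I_N -> 'I_s -> R)
    (u : 'I_r -> R) (xi : 'I_r -> R -> 'rV[R]_d) (w0 : 'I_r -> R)
    (w : 'I_N -> 'I_r -> nat -> R) :
  (forall j, expands p (y t) D (xi j) (w0 j) (fun sigma => w sigma j)) ->
  expands p (y t) D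
    (fun h => h *: (\sum_sigma \sum_j a sigma j *: phi sigma (t + c j * h))
              + \sum_j u j *: xi j h)
    (\sum_j u j * w0 j)
    (fun sigma k => \sum_j a sigma j * (c j ^+ k.-1 / k.-1`!%:R)
                    + \sum_j u j * w sigma j k).
Proof.
move=> Hxi.
have H1 sigma : partition_expands p D sigma
    (fun h => \sum_j a sigma j *: (h *: phi sigma (t + c j * h)))
    (fun k => \sum_j a sigma j * (c j ^+ k.-1 / k.-1`!%:R)).
  by apply: partition_expands_sum => j; exact: stage_expands.
apply: expands_ext (expandsD (expands_parts (y t) H1) (expands_sum (index_enum _) u Hxi)) => //.
- near=> h; congr (_ + _); rewrite scaler_sumr; apply: eq_bigr => sigma _.
  by rewrite scaler_sumr; apply: eq_bigr => j _; rewrite !scalerA mulrC.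
- by rewrite add0r.
Unshelve. all: by end_near. Qed.

End along_solution.

(** * Sufficiency of the order conditions *)

(** Summing the estimates over [I] bounds the total error by [h * #|I| * |K|] times itself plus the
    sum of the [b]. Once that factor is at most 1/2 it is absorbed on the left, whence the 2 in the
    final constant. *)
Lemma Oh_self_bounded (R : realType) (V : normedModType R) (I : finType)
    (e b : I -> R -> V) (K : R) n :
  (forall i, Oh n (b i)) ->
  (\forall h \near 0^'+, forall i,
     `|e i h| <= h * (K * \sum_j `|e j h|) + `|b i h|) ->
  forall i, Oh n (e i).
Proof.
move=> Hb He i.
have /choice[C HC] : forall i, exists C, \forall h \near 0^'+, `|b i h| <= C * h ^+ n.
  by move=> j; apply/OhP.
have HC' : \forall h \near 0^'+, forall i, `|b i h| <= C i * h ^+ n.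
  exact: (@filter_forall _ _ (fun i h => `|b i h| <= C i * h ^+ n) _ _ HC).
pose m : R := #|I|%:R.
(* Adding 1 keeps the threshold on [h] well defined when [m * |K|] is 0. *)
have mK : 0 < m * `|K| + 1 by rewrite ltr_wpDl// mulr_ge0.
apply/OhP; exists (2 * \sum_i C i); near=> h.
have h0 : 0 < h by near: h; exact: nbhs_right_gt.
set E := \sum_j `|e j h|.
have iE : `|e i h| <= E by rewrite /E (bigD1 i)//= lerDl sumr_ge0.
apply: (le_trans iE).
have E0 : 0 <= E by exact: sumr_ge0.
have hm : h * (m * `|K|) <= 2^-1.
  apply: le_trans (_ : h * (m * `|K| + 1) <= _).
    by rewrite ler_pM2l// lerDl.
  rewrite -ler_pdivlMr//; near: h; apply: nbhs_right_le.
  by rewrite divr_gt0.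
have EE : E <= h * (m * `|K|) * E + (\sum_i C i) * h ^+ n.
  have -> : h * (m * `|K|) * E = \sum_(j : I) h * (`|K| * E).
    by rewrite sumr_const -[#|_|]/(#|I|) -mulr_natl -/m; ring.
  rewrite mulr_suml -big_split; apply: ler_sum => j _ /=.
  have := near He h; move/(_ _ j)/le_trans; apply => //.
  rewrite lerD//; last by move: j; near: h.
  by rewrite ler_pM2l// ler_wpM2r// ler_norm.
have : h * (m * `|K|) * E <= 2^-1 * E by rewrite ler_wpM2r.
lra.
Unshelve. all: by end_near. Qed.

(* The conditions at [k] are the coefficients of [h ^ k] in the stages and in
   the external vectors; the inner conditional is [1 / (k - l)!], guarded
   against the truncated subtraction. *)
Definition order_cond (R : realType) (s r p q : nat) (c : 'I_s -> R)
    (A : 'M[R]_s) (U : 'M[R]_(s, r)) (B : 'M[R]_(r, s)) (V : 'M[R]_r)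
    (w0 : 'I_r -> R) (w : 'I_r -> nat -> R) : Prop :=
  [/\ forall i, \sum_j U i j * w0 j = 1,
      forall i k, (1 <= k < q.+1)%N ->
        \sum_j A i j * (c j ^+ k.-1 / k.-1`!%:R) + \sum_j U i j * w j k
        = c i ^+ k / k`!%:R,
      forall i, \sum_j V i j * w0 j = w0 i &
      forall i k, (1 <= k < p.+1)%N ->
        \sum_j B i j * (c j ^+ k.-1 / k.-1`!%:R) + \sum_j V i j * w j k
        = w0 i / k`!%:R + \sum_(1 <= l < p.+1)
            w i l * (if (l <= k)%N then (k - l)`!%:R^-1 else 0)].

(** The matrix of [pglm_order] with the coefficients fixed, so that conditions on given [w0] and [w]
    can be stated. *)
Definition pglm_order_with (R : realType) (N s r p q : nat) (M : pglm R N s r)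
    (w0 : 'I_N -> 'I_r -> R) (w : 'I_N -> 'I_N -> 'I_r -> nat -> R) : Prop :=
  forall (d : nat) (f : 'I_N -> 'rV[R]_d -> 'rV[R]_d) (y : R -> 'rV[R]_d)
    (t : R) (xi : R -> 'I_N -> 'I_r -> 'rV[R]_d)
    (Y : R -> 'I_N -> 'I_s -> 'rV[R]_d) (xi' : R -> 'I_N -> 'I_r -> 'rV[R]_d),
  (forall sigma, smooth (f sigma)) ->
  solves_near (fun x => \sum_sigma f sigma x) y t ->
  (\forall h \near 0^'+, pglm_step M f h (xi h) (Y h) (xi' h)) ->
  (forall mu i, Oh 0 (fun h => Y h mu i)) ->
  (forall mu i,
     Oh p.+1 (fun h => xi h mu i - pglm_external p w0 w f y h t mu i)) ->
  (forall mu i, Oh q.+1 (fun h => Y h mu i - y (t + pglm_c M mu i * h))) /\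
  (forall mu i,
     Oh p.+1 (fun h => xi' h mu i - pglm_external p w0 w f y h (t + h) mu i)).

Lemma sum_block (R : realType) (V : lmodType R) (N n r : nat) (mu : 'I_N)
    (U : 'M[R]_(n, r)) (i : 'I_n) (xi : 'I_N -> 'I_r -> V) :
  \sum_sigma \sum_j (if mu == sigma then U else 0) i j *: xi sigma j
  = \sum_j U i j *: xi mu j.
Proof.
rewrite (bigD1 mu)//= eqxx [X in _ + X]big1 ?addr0// => sigma smu.
by rewrite big1// => j _; rewrite eq_sym (negbTE smu) mxE scale0r.
Qed.

Section block_diagonal.
Context {R : realType} {N s r : nat}.
Variables (p q : nat) (c : 'I_s -> R) (U : 'M[R]_(s, r)) (V : 'M[R]_r).
Variable M : pglm R N s r.
Hypothesis Mc : forall mu, pglm_c M mu = c.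
Hypothesis MU : forall mu sigma, pglm_U M mu sigma = if mu == sigma then U else 0.
Hypothesis MV : forall mu sigma, pglm_V M mu sigma = if mu == sigma then V else 0.
Variables (w0 : 'I_N -> 'I_r -> R) (w : 'I_N -> 'I_N -> 'I_r -> nat -> R).

Lemma order_cond_pglm : (q <= p <= q.+1)%N ->
  (forall mu sigma, order_cond p q c (pglm_A M mu sigma) U (pglm_B M mu sigma) V
     (w0 mu) (w mu sigma)) ->

  pglm_order_with p q M w0 w.
Proof.
move=> /andP[qp pq] Hoc d f y t xi Y xi' sf sol step bY Hxi.
pose D sigma k := derive1n k.-1 (fun u => f sigma (y u)) t.
have Hxi' mu j : expands p (y t) D (fun h => xi h mu j) (w0 mu j)
    (fun sigma k => w mu sigma j k) := Hxi mu j.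
pose dev sigma j h := f sigma (Y h sigma j) - f sigma (y (t + c j * h)).
have stages : \forall h \near 0^'+, forall mu i, Y h mu i =
    h *: (\sum_sigma \sum_j pglm_A M mu sigma i j *: f sigma (y (t + c j * h)))
    + \sum_j U i j *: xi h mu j
    + h *: (\sum_sigma \sum_j pglm_A M mu sigma i j *: dev sigma j h).
  apply: filterS step => h [HY _] mu i; rewrite HY.
  under [X in _ + X = _]eq_bigr do rewrite MU; rewrite sum_block addrAC -scalerDr.
  congr (h *: _ + _); rewrite -big_split/=; apply: eq_bigr => sigma _.
  by rewrite -big_split/=; apply: eq_bigr => j _; rewrite -scalerDr addrC subrK.
have externals : \forall h \near 0^'+, forall mu i, xi' h mu i =
    h *: (\sum_sigma \sum_j pglm_B M mu sigma i j *: f sigma (y (t + c j * h)))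
    + \sum_j V i j *: xi h mu j
    + h *: (\sum_sigma \sum_j pglm_B M mu sigma i j *: dev sigma j h).
  apply: filterS step => h [_ HY] mu i; rewrite HY.
  under [X in _ + X = _]eq_bigr do rewrite MV; rewrite sum_block addrAC -scalerDr.
  congr (h *: _ + _); rewrite -big_split/=; apply: eq_bigr => sigma _.
  by rewrite -big_split/=; apply: eq_bigr => j _; rewrite -scalerDr addrC subrK.
(* The errors of all block rows are estimated together, since each stage depends on those of every
   partition; [b] is the residual of the exact solution in the stage equations. *)
pose e (x : 'I_N * 'I_s) h := Y h x.1 x.2 - y (t + c x.2 * h).
pose b (x : 'I_N * 'I_s) h :=
  h *: (\sum_sigma \sum_j pglm_A M x.1 sigma x.2 j *: f sigma (y (t + c j * h)))
    + \sum_j U x.2 j *: xi h x.1 j - y (t + c x.2 * h).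
have Ob x : Oh q.+1 (b x).
  have H1 := rhs_expands sf sol c (fun sigma => pglm_A M x.1 sigma x.2) (U x.2) (Hxi' x.1).
  have H := expandsB H1 (sol_expands p sf sol (c x.2)).
  apply: expands_Oh qp H _ _.
    have [-> _ _ _] := Hoc x.1 x.1; exact: subrr.
  move=> sigma k kq; have [_ H2 _ _] := Hoc x.1 sigma.
  by rewrite H2// subrr.
have [L HL] : exists L, \forall h \near 0^'+, forall sigma j,
    `|dev sigma j h| <= L * `|e (sigma, j) h|.
  have /choice[C1 HC1] : forall x : 'I_N * 'I_s, exists C,
      \forall h \near 0^'+, `|Y h x.1 x.2| <= C /\ `|y (t + c x.2 * h)| <= C.
    move=> x; have /OhP[C1 HC1] := bY x.1 x.2.
    have /OhP[C2 HC2] := sol_Oh0 sf sol (c x.2).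
    exists (Num.max C1 C2); apply: filterS2 HC1 HC2 => h.
    by rewrite !expr0 !mulr1 !le_max => -> ->; rewrite orbT.
  (* One radius for all stages: the assumed boundedness of [Y] confines them, together with the
     exact values, to a ball on which each [f sigma] is Lipschitz. *)
  pose C := \big[Num.max/0]_x C1 x.
  have /choice[L HL] : forall sigma, exists L, 0 <= L /\ forall x y,
      `|x| <= C -> `|y| <= C -> `|f sigma x - f sigma y| <= L * `|x - y|.
    by move=> sigma; have [L L0 HL] := smooth_lipschitz C (sf sigma); exists L.
  have H1 : \forall h \near 0^'+, forall x : 'I_N * 'I_s,
      `|Y h x.1 x.2| <= C1 x /\ `|y (t + c x.2 * h)| <= C1 x.
    exact: (@filter_forall _ _ (fun (x : 'I_N * 'I_s) h =>
      `|Y h x.1 x.2| <= C1 x /\ `|y (t + c x.2 * h)| <= C1 x) _ _ HC1).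
  exists (\sum_sigma L sigma); apply: filterS H1 => h H1 sigma j.
  have [H2 H3] := H1 (sigma, j).
  have C1C : C1 (sigma, j) <= C by apply: le_bigmax.
  have [L0 HLs] := HL sigma.
  apply: le_trans (HLs _ _ (le_trans H2 C1C) (le_trans H3 C1C)) _.
  rewrite ler_wpM2r// (bigD1 sigma)//= lerDl sumr_ge0// => tau _.
  by have [] := HL tau.
(* The sum of all entries dominates every row sum, so a single constant serves all components. *)
pose K0 := \sum_mu \sum_sigma \sum_i \sum_j `|pglm_A M mu sigma i j|.
have Oe x : Oh q.+1 (e x).
  apply: (Oh_self_bounded (K := K0 * `|L|) Ob) => {x}.
  near=> h; have h0 : 0 < h by near: h; exact: nbhs_right_gt.
  have HS : forall mu i, Y h mu i =
    h *: (\sum_sigma \sum_j pglm_A M mu sigma i j *: f sigma (y (t + c j * h)))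
    + \sum_j U i j *: xi h mu j
    + h *: (\sum_sigma \sum_j pglm_A M mu sigma i j *: dev sigma j h).
    by near: h.
  have HLh : forall sigma j, `|dev sigma j h| <= L * `|e (sigma, j) h| by near: h.
  move=> [mu i].
  have -> : e (mu, i) h = b (mu, i) h +
      h *: (\sum_sigma \sum_j pglm_A M mu sigma i j *: dev sigma j h).
    by rewrite /e /b /= HS addrAC.
  apply: le_trans (ler_normD _ _) _; rewrite addrC lerD2r normrZ gtr0_norm//.
  rewrite ler_pM2l//.
  apply: le_trans (ler_norm_sum _ _ _) _.
  apply: le_trans (_ : \sum_sigma \sum_j
    `|pglm_A M mu sigma i j| * (`|L| * \sum_x `|e x h|) <= _).
    apply: ler_sum => sigma _; apply: le_trans (ler_norm_sum _ _ _) _.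
    apply: ler_sum => j _; rewrite normrZ ler_wpM2l//.
    apply: le_trans (HLh sigma j) _.
    apply: le_trans (_ : `|L| * `|e (sigma, j) h| <= _); first by rewrite ler_wpM2r// ler_norm.
    by rewrite ler_wpM2l// (bigD1 (sigma, j))//= lerDl sumr_ge0.
  rewrite -mulrA; under eq_bigr do rewrite -mulr_suml; rewrite -mulr_suml.
  apply: ler_wpM2r; first by rewrite mulr_ge0// sumr_ge0.
  rewrite /K0 [leRHS](bigD1 mu)//= -[leLHS]addr0 lerD//; last first.
    by do 4! [apply: sumr_ge0 => ? _].
  apply: ler_sum => sigma _; rewrite [leRHS](bigD1 i)//= lerDl.
  by do 2! [apply: sumr_ge0 => ? _].
split=> mu i; first by rewrite Mc; exact: (Oe (mu, i)).
have Odev sigma j : Oh q.+1 (dev sigma j).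
  have /OhP[C HC] := Oe (sigma, j); apply/OhP; exists (`|L| * C); near=> h.
  apply: le_trans (_ : L * `|e (sigma, j) h| <= _).
    have HLh : forall tau i, `|dev tau i h| <= L * `|e (tau, i) h| by near: h.
    exact: HLh.
  apply: le_trans (_ : `|L| * `|e (sigma, j) h| <= _); first by rewrite ler_wpM2r// ler_norm.
  by rewrite -mulrA ler_wpM2l//; near: h.
have H1 := rhs_expands sf sol c (fun sigma => pglm_B M mu sigma i) (V i) (Hxi' mu).
have H2 := external_expands p sf sol (w0 mu i) (fun sigma k => w mu sigma i k).
have H3 := expandsB H1 H2.
(* The factor [h] raises the stage error to order [q + 2], which reaches [p + 1] because
   [p <= q + 1]. *)
have OH : Oh p.+1 (fun h =>
    h *: (\sum_sigma \sum_j pglm_B M mu sigma i j *: dev sigma j h)).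
  apply: (Oh_le (_ : (p.+1 <= 1 + q.+1)%N)); first by rewrite add1n ltnS.
  rewrite -[X in Oh _ X]/(fun h => h ^+ 1 *: _); apply: Oh_shift.
  by apply: Oh_sum => sigma _; apply: Oh_sum => j _; apply: OhZ.
have H4 : Oh p.+1 (fun h =>
    (h *: (\sum_sigma \sum_j pglm_B M mu sigma i j *: f sigma (y (t + c j * h)))
     + \sum_j V i j *: xi h mu j) - pglm_external p w0 w f y h (t + h) mu i).
  apply: expands_Oh (leqnn p) H3 _ _.
    have [_ _ -> _] := Hoc mu mu; exact: subrr.
  move=> sigma k kq; have [_ _ _ H5] := Hoc mu sigma.
  by rewrite H5// subrr.
apply: Oh_near (OhD H4 OH); near=> h.
have -> : xi' h mu i =
    h *: (\sum_sigma \sum_j pglm_B M mu sigma i j *: f sigma (y (t + c j * h)))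
    + \sum_j V i j *: xi h mu j
    + h *: (\sum_sigma \sum_j pglm_B M mu sigma i j *: dev sigma j h).
  have Hx : forall mu i, xi' h mu i =
    h *: (\sum_sigma \sum_j pglm_B M mu sigma i j *: f sigma (y (t + c j * h)))
    + \sum_j V i j *: xi h mu j
    + h *: (\sum_sigma \sum_j pglm_B M mu sigma i j *: dev sigma j h) by near: h.
  exact: Hx.
by rewrite addrAC.
Unshelve. all: by end_near. Qed.

End block_diagonal.

(** * Necessity of the order conditions *)

Section plane.
Context {R : realType}.
Implicit Types (a b : R).

Definition vec2 a b : 'rV[R]_2 := a *: delta_mx 0 0 + b *: delta_mx 0 1.

Lemma vec2D a b a' b' : vec2 a b + vec2 a' b' = vec2 (a + a') (b + b').
Proof. by rewrite /vec2 !scalerDl addrACA. Qed.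

Lemma vec2Z k a b : k *: vec2 a b = vec2 (k * a) (k * b).
Proof. by rewrite /vec2 scalerDr !scalerA. Qed.

Lemma vec2B a b a' b' : vec2 a b - vec2 a' b' = vec2 (a - a') (b - b').
Proof. by rewrite -scaleN1r vec2Z !mulN1r vec2D. Qed.

Lemma vec2_sum (I : Type) (r : seq I) (P : pred I) (a b : I -> R) :
  \sum_(i <- r | P i) vec2 (a i) (b i)
  = vec2 (\sum_(i <- r | P i) a i) (\sum_(i <- r | P i) b i).
Proof. by rewrite /vec2 big_split/= !scaler_suml. Qed.

Lemma vec2_0 a b : vec2 a b 0 0 = a.
Proof. by rewrite !mxE/= mulr1 mulr0 addr0. Qed.

Lemma vec2_1 a b : vec2 a b 0 1 = b.
Proof. by rewrite !mxE/= mulr1 mulr0 add0r. Qed.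

Lemma Oh_coord k d (g : R -> 'rV[R]_d) j : Oh k g -> Oh k (fun h => g h 0 j : R).
Proof.
move=> /OhP[C HC]; apply/OhP; exists C; apply: filterS HC => h.
by apply: le_trans; exact: ler_coord_norm.
Qed.

Lemma Oh_vec2 k m n a b :
  Oh k (fun h => vec2 (h ^+ m * a) (h ^+ n * b)) ->
  ((m < k)%N -> a = 0) /\ ((n < k)%N -> b = 0).
Proof.
move=> H; split=> mk.
  apply: (Oh_monomial_eq0 mk (v := a : R)).
  by apply: Oh_near (Oh_coord 0 H); near=> h; rewrite vec2_0.
apply: (Oh_monomial_eq0 mk (v := b : R)).
by apply: Oh_near (Oh_coord 1 H); near=> h; rewrite vec2_1.
Unshelve. all: by end_near. Qed.

Lemma derive1n_cst0 (W : normedModType R) n (u : R) :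
  derive1n n (fun=> 0 : W) u = 0.
Proof.
elim: n u => // n IH u; rewrite derive1nS (_ : derive1n n _ = fun=> 0).
  by rewrite derive1_cst.
by apply/funext => z; rewrite IH.
Qed.

(** For [j > n] the falling factorial vanishes, so the truncated exponent [n - j] does no harm. *)
Lemma derive1n_monomial n j (u : R) :
  derive1n j (fun z => vec2 1 (z ^+ n)) u
  = vec2 (j == 0%N)%:R ((n ^_ j)%:R * u ^+ (n - j)).
Proof.
elim: j u => [|j IH] u; first by rewrite ffactn0 subn0 mul1r.
rewrite derive1nS (_ : derive1n j _ =
    cst ((j == 0%N)%:R *: delta_mx 0 0)
    + (fun z => z ^+ (n - j) *: ((n ^_ j)%:R *: delta_mx 0 1))).
  rewrite derive1E.
  have D := is_deriveD
     (is_derive_cst ((j == 0%N)%:R *: delta_mx 0 0 : 'rV[R]_2) u (1 : R))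
     (is_derive_expZ ((n ^_ j)%:R *: delta_mx 0 1 : 'rV[R]_2) (n - j) u).
  rewrite (derive_val (is_derive := D)) /vec2 scale0r !add0r scalerA subnS ffactnSr natrM.
  by congr (_ *: _); ring.
by apply/funext => z; rewrite IH /vec2 [in RHS]/GRing.add/= scalerA mulrC.
Qed.

End plane.

Section necessity.
Context {R : realType} {N s r : nat}.
Variables (p q : nat) (c : 'I_s -> R) (U : 'M[R]_(s, r)) (V : 'M[R]_r).
Variable M : pglm R N s r.
Hypothesis Mc : forall mu, pglm_c M mu = c.
Hypothesis MU : forall mu sigma, pglm_U M mu sigma = if mu == sigma then U else 0.
Hypothesis MV : forall mu sigma, pglm_V M mu sigma = if mu == sigma then V else 0.
Variables (w0 : 'I_N -> 'I_r -> R) (w : 'I_N -> 'I_N -> 'I_r -> nat -> R).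
Hypothesis M_order : pglm_order_with p q M w0 w.

(** Tested on [f = 0] with a constant solution: stages and outputs do not depend on [h], so an error
    of positive order must be 0. *)
Lemma pglm_order_cond0 mu :
  (forall i, \sum_j U i j * w0 mu j = 1) /\
  (forall i, \sum_j V i j * w0 mu j = w0 mu i).
Proof.
pose e : 'rV[R]_1 := const_mx 1.
pose f (sigma : 'I_N) (x : 'rV[R]_1) : 'rV[R]_1 := 0.
have e0 : e != 0.
  by apply/eqP => /matrixP/(_ 0 0); rewrite !mxE => /eqP; rewrite oner_eq0.
have ext h u nu i : pglm_external p w0 w f (fun=> e) h u nu i = w0 nu i *: e.
  rewrite /pglm_external big1 ?addr0// => sigma _; rewrite big1// => k _.
  by rewrite derive1n_cst0 scaler0.
have rhs0 h n' (X : 'I_N -> 'M[R]_(n', s)) i z : h *: (\sum_sigma \sum_j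
    X sigma i j *: f sigma (z sigma j)) = 0.
  by rewrite big1 ?scaler0// => sigma _; rewrite big1// => j _; rewrite scaler0.
have [|||||HY Hxi] := @M_order 1%N f (fun=> e) 0 (fun _ nu j => w0 nu j *: e)
  (fun _ nu i => (\sum_j U i j * w0 nu j) *: e)
  (fun _ nu i => (\sum_j V i j * w0 nu j) *: e).
- by move=> sigma k; exact: Ck_cst.
- near=> u; rewrite big1//; exact: is_derive_cst.
- near=> h; split=> nu i.
    rewrite rhs0 add0r; under [RHS]eq_bigr do rewrite MU; rewrite sum_block scaler_suml.
    by apply: eq_bigr => j _; rewrite scalerA.
  rewrite rhs0 add0r; under [RHS]eq_bigr do rewrite MV; rewrite sum_block scaler_suml.
  by apply: eq_bigr => j _; rewrite scalerA.
- move=> nu i.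
  apply: Oh_near (Oh_monomial ((\sum_j U i j * w0 nu j) *: e) (leqnn 0)).
  by near=> h; rewrite expr0 scale1r.
- move=> nu i; apply: Oh_near (Oh0 _); near=> h.
  by rewrite ext subrr.
have inj (a b : R) k : Oh k.+1 (fun=> a *: e - b *: e) -> a = b.
  move=> H; have : a *: e - b *: e = 0.
    apply: (Oh_monomial_eq0 (ltn0Sn k)).
    by apply: Oh_near H; near=> h; rewrite expr0 scale1r.
  by rewrite -scalerBl => /eqP; rewrite scaler_eq0 (negbTE e0) orbF subr_eq0 => /eqP.
split=> i.
  by apply: (@inj _ _ q); apply: Oh_near (HY mu i); near=> h; rewrite scale1r.
by apply: (@inj _ _ p); apply: Oh_near (Hxi mu i); near=> h; rewrite ext.
Unshelve. all: by end_near. Qed.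

Section quadrature.
Variables (sigma : 'I_N) (n : nat).
Hypothesis np : (n < p)%N.

(** Autonomous form of the quadrature of [u ^+ n]: the first coordinate of the solution is the time
    itself. *)
Let g (x : 'rV[R]_2) : 'rV[R]_2 := vec2 1 (x 0 0 ^+ n).
Let f (tau : 'I_N) (x : 'rV[R]_2) : 'rV[R]_2 := if tau == sigma then g x else 0.
Let y (u : R) : 'rV[R]_2 := vec2 u (u ^+ n.+1 / n.+1%:R).

Let g_smooth : smooth g.
Proof.
move=> k; apply: CkD; first exact: Ck_cst.
apply: Ck_scale; last exact: Ck_cst.
by apply: Ck_exp; exact: Ck_coord_id.
Qed.

Let f_smooth tau : smooth (f tau).
Proof. by rewrite /f; case: eqP => _ k; [exact: g_smooth|exact: Ck_cst]. Qed.

Let y_sol : solves_near (fun x => \sum_tau f tau x) y 0.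
Proof.
near=> u; rewrite (bigD1 sigma)//= /f eqxx big1 ?addr0; last first.
  by move=> tau /negbTE ->.
rewrite /g vec2_0.
rewrite (_ : y = (fun z => z ^+ 1 *: delta_mx 0 0)
   + (fun z => z ^+ n.+1 *: (n.+1%:R^-1 *: delta_mx 0 1))); last first.
  by apply/funext => z; rewrite /y /vec2 [in RHS]/GRing.add/= scalerA expr1.
apply: is_derive_eq (is_deriveD (is_derive_expZ _ 1 u) (is_derive_expZ _ n.+1 u)) _.
rewrite /vec2 scalerA expr0 mulr1; congr (_ + _ *: _).
by rewrite mulrAC mulfV ?mul1r// pnatr_eq0.
Unshelve. all: by end_near. Qed.

Let ext h u nu i : pglm_external p w0 w f y h u nu i =
  vec2 (w0 nu i * u + w nu sigma i 1 * h)
    (w0 nu i * (u ^+ n.+1 / n.+1%:R)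
     + \sum_(1 <= k < p.+1) w nu sigma i k * h ^+ k
         * ((n ^_ k.-1)%:R * u ^+ (n - k.-1))).
Proof.
rewrite /pglm_external (bigD1 sigma)//= [X in _ + (_ + X)]big1 ?addr0; last first.
  move=> tau /negbTE ts; rewrite big1// => k _.
  by rewrite /f ts derive1n_cst0 scaler0.
have -> : (fun u => f sigma (y u)) = fun z => vec2 1 (z ^+ n).
  by apply/funext => z; rewrite /f eqxx /g vec2_0.
under eq_bigr do rewrite derive1n_monomial vec2Z.
rewrite vec2_sum vec2Z vec2D; congr (vec2 (_ + _) _).
have p0 : (0 < p)%N by exact: leq_ltn_trans np.
(* The first coordinate of [g] is constant, so only [k = 1] contributes to it. *)
rewrite big_ltn// expr1 /= mulr1 big_nat big1 ?addr0// => -[//|[//|k]] _.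
by rewrite /= mulr0.
Qed.

(* As [f] only depends on the first coordinate of the stages, and that
   coordinate is affine in the data, the stage equations solve explicitly:
   the stages are [(h * tau_, h ^ n.+1 * chi)]. *)
Let tau_ (nu : 'I_N) i := \sum_j pglm_A M nu sigma i j + \sum_j U i j * w nu sigma j 1.
Let chi n' (X : 'M[R]_(n', s)) (Z : 'M[R]_(n', r)) (nu : 'I_N) (i : 'I_n') :=
  \sum_j X i j * tau_ sigma j ^+ n + n`!%:R * \sum_j Z i j * w nu sigma j n.+1.
Let xi h nu j := vec2 (h * w nu sigma j 1) (h ^+ n.+1 * (n`!%:R * w nu sigma j n.+1)).
Let stage n' (X : 'M[R]_(n', s)) (Z : 'M[R]_(n', r)) h (nu : 'I_N) (i : 'I_n') :=
  vec2 (h * (\sum_j X i j + \sum_j Z i j * w nu sigma j 1)) (h ^+ n.+1 * chi X Z nu i).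
Let Y h nu i := stage (pglm_A M nu sigma) U h nu i.

Let ext_xi h nu j : pglm_external p w0 w f y h 0 nu j = xi h nu j.
Proof.
rewrite ext mulr0 add0r exprS mul0r mul0r mulr0 add0r mulrC; congr vec2.
rewrite (bigD1_seq n.+1)/= ?mem_index_iota ?iota_uniq//=.
rewrite subnn expr0 mulr1 ffactnn big_nat_cond big1 ?addr0; last first.
  move=> [//|k] /andP[_ /=]; rewrite eqSS => kn.
  (* At time 0 only the index [n + 1] survives: below it a positive power of 0 appears, above it the
     falling factorial is 0. *)
  have [kn'|nk] := ltnP k n; last first.
    by rewrite ffact_small ?mul0r ?mulr0// ltn_neqAle eq_sym kn.
  by rewrite expr0n subn_eq0 leqNgt kn' !mulr0.
by ring.
Qed.

Let stageE n' (X : 'I_N -> 'M[R]_(n', s)) (Z : 'M[R]_(n', r)) h nu i :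
  h *: (\sum_tau \sum_j X tau i j *: f tau (Y h tau j))
  + \sum_tau \sum_j (if nu == tau then Z else 0) i j *: xi h tau j
  = stage (X sigma) Z h nu i.
Proof.
rewrite sum_block (bigD1 sigma)//= [X in _ *: (_ + X)]big1 ?addr0; last first.
  by move=> tau /negbTE ts; rewrite big1// => j _; rewrite /f ts scaler0.
have E j : f sigma (Y h sigma j) = vec2 1 (h ^+ n * tau_ sigma j ^+ n).
  by rewrite /f eqxx /g vec2_0 exprMn.
under eq_bigr do rewrite E vec2Z; under [X in _ + X]eq_bigr do rewrite vec2Z.
rewrite !vec2_sum vec2Z vec2D /stage /chi; congr vec2.
  rewrite mulrDr [in RHS]mulr_sumr; congr (h * _ + _).
    by apply: eq_bigr => j _; rewrite mulr1.
  by apply: eq_bigr => j _; rewrite mulrCA.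
rewrite mulrDr !mulr_sumr; congr (_ + _).
  by apply: eq_bigr => j _; rewrite exprS; ring.
by apply: eq_bigr => j _; ring.
Qed.

(** The errors have coordinates that are multiples of [h] and [h ^+ n.+1]; a multiple vanishes as
    soon as its exponent is below the order of the error. *)
Lemma pglm_order_quadrature nu :
  ((0 < q)%N -> forall i, tau_ nu i = c i) /\
  ((n < q)%N -> forall i, chi (pglm_A M nu sigma) U nu i = c i ^+ n.+1 / n.+1%:R) /\
  (forall i, chi (pglm_B M nu sigma) V nu i =
     w0 nu i / n.+1%:R + \sum_(1 <= k < p.+1) w nu sigma i k * (n ^_ k.-1)%:R).
Proof.
have [|||HY Hxi] := @M_order 2%N f y 0 xi Y
  (fun h nu i => stage (pglm_B M nu sigma) V h nu i) f_smooth y_sol.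
- near=> h; split=> mu i.
    by under [X in _ = _ + X]eq_bigr do rewrite MU; rewrite stageE.
  by under [X in _ = _ + X]eq_bigr do rewrite MV; rewrite stageE.
- move=> mu i; apply: Oh_near
    (OhD (Oh_monomial (tau_ mu i *: delta_mx 0 0 : 'rV[R]_2) (leq0n 1))
         (Oh_monomial (chi (pglm_A M mu sigma) U mu i *: delta_mx 0 1) (leq0n n.+1))).
  by near=> h; rewrite expr1 !scalerA.
- by move=> mu i; apply: Oh_near (Oh0 _); near=> h; rewrite ext_xi subrr.
have HY' i : Oh q.+1 (fun h => vec2 (h ^+ 1 * (tau_ nu i - c i))
    (h ^+ n.+1 * (chi (pglm_A M nu sigma) U nu i - c i ^+ n.+1 / n.+1%:R))).
  apply: Oh_near (HY nu i); near=> h; rewrite Mc add0r /Y /stage /y vec2B.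
  by rewrite exprMn /tau_; congr vec2; [ring|rewrite mulrBr; congr (_ - _); ring].
have Hxi' i : Oh p.+1 (fun h => vec2
    (h ^+ 1 * (\sum_j pglm_B M nu sigma i j + \sum_j V i j * w nu sigma j 1
               - (w0 nu i + w nu sigma i 1)))
    (h ^+ n.+1 * (chi (pglm_B M nu sigma) V nu i - (w0 nu i / n.+1%:R
       + \sum_(1 <= k < p.+1) w nu sigma i k * (n ^_ k.-1)%:R)))).
  apply: Oh_near (Hxi nu i); near=> h; rewrite add0r ext /stage vec2B.
  congr vec2; first by ring.
  rewrite mulrBr; congr (_ - _); rewrite mulrDr mulr_sumr; congr (_ + _); first by ring.
  apply: eq_big_nat => -[//|k] _ /=.
  have [kn|nk] := leqP k n; last by rewrite ffact_small// !mulr0 mul0r mulr0.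
  have -> : h ^+ n.+1 = h ^+ k.+1 * h ^+ (n - k) by rewrite -exprD addSn subnKC.
  by ring.
split; last split.
- move=> q0 i; have [/(_ q0)/eqP + _] := Oh_vec2 (HY' i).
  by rewrite subr_eq0 => /eqP.
- move=> nq i; have [_ /(_ nq)/eqP] := Oh_vec2 (HY' i).
  by rewrite subr_eq0 => /eqP.
- move=> i; have [_ /(_ np)/eqP] := Oh_vec2 (Hxi' i).
  by rewrite subr_eq0 => /eqP.
Unshelve. all: by end_near. Qed.

End quadrature.

Lemma pglm_order_cond : (1 <= p)%N -> (q <= p <= q.+1)%N -> forall mu sigma,
  order_cond p q c (pglm_A M mu sigma) U (pglm_B M mu sigma) V (w0 mu) (w mu sigma).
Proof.
move=> p1 /andP[qp pq] mu sigma; have [U1 V1] := pglm_order_cond0 mu.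
(* The quadrature identities contain [tau_] where the conditions contain [c]. For [n > 0],
   [n < p <= q + 1] forces [q > 0], so both agree; for [n = 0] both powers are 1. *)
have tauX n j : (n < p)%N ->
   (\sum_l pglm_A M sigma sigma j l + \sum_l U j l * w sigma sigma l 1) ^+ n = c j ^+ n.
  case: n => [|n] np; first by rewrite !expr0.
  have [H _] := pglm_order_quadrature sigma np sigma.
  by rewrite H//; move: (leq_trans np pq); rewrite ltnS; case: (q).
have nf0 n : n`!%:R != 0 :> R by rewrite pnatr_eq0 -lt0n fact_gt0.
split=> // i [//|n] /andP[_ np] /=; rewrite ltnS in np.
- have [_ [H _]] := pglm_order_quadrature sigma (leq_trans np qp) mu.
  (* The quadrature identity is the order condition at [n + 1] multiplied by [n!]. *)
  apply: (mulfI (nf0 n)); have := H np i.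
  rewrite factS natrM mulrDr => E; transitivity (c i ^+ n.+1 / n.+1%:R).
    rewrite -E; congr (_ + _); rewrite mulr_sumr; apply: eq_bigr => j _.
    by rewrite tauX ?(leq_trans np qp)//; field.
  by field; rewrite nf0 addrC natr1 pnatr_eq0.
- have [_ [_ H]] := pglm_order_quadrature sigma np mu.
  apply: (mulfI (nf0 n)); have := H i.
  rewrite factS natrM !mulrDr => E.
  transitivity (w0 mu i / n.+1%:R +
      \sum_(1 <= k < p.+1) w mu sigma i k * (n ^_ k.-1)%:R).
    rewrite -E; congr (_ + _); rewrite mulr_sumr; apply: eq_bigr => j _.
    by rewrite tauX//; field.
  congr (_ + _); first by field; rewrite nf0 addrC natr1 pnatr_eq0.
  rewrite mulr_sumr; apply: eq_big_nat => -[//|k] _ /=; rewrite ltnS subSS.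
  have [kn|nk] := leqP k n; last by rewrite ffact_small// !mulr0.
  (* The quotient of [n!] by [(n - k)!] is the falling factorial in the quadrature identity. *)
  rewrite -(ffact_fact kn) natrM.
  have := nf0 (n - k)%N => ?.
  by field.
Qed.

End necessity.

(** * Single methods *)

(** Since [q <= p], the conditions read [w] only at [1 <= k <= p]; outside this range the columns
    taken through [inord] are meaningless. *)
Lemma order_cond_ext (R : realType) (s r p q : nat) (c : 'I_s -> R)
    (A : 'M[R]_s) (U : 'M[R]_(s, r)) (B : 'M[R]_(r, s)) (V : 'M[R]_r)
    (w0 w0' : 'I_r -> R) (w w' : 'I_r -> nat -> R) :
  (q <= p)%N -> w0 =1 w0' ->
  (forall i k, (1 <= k < p.+1)%N -> w i k = w' i k) ->
  order_cond p q c A U B V w0 w -> order_cond p q c A U B V w0' w'.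
Proof.
move=> qp /funext <- ww' [H1 H2 H3 H4]; split=> // i k kp.
  have kp' : (1 <= k < p.+1)%N.
    by case/andP: kp => -> /= /leq_trans; apply; rewrite ltnS.
  by rewrite -H2//; congr (_ + _); apply: eq_bigr => j _; rewrite ww'.
transitivity (w0 i / k`!%:R + \sum_(1 <= l < p.+1)
    w i l * (if (l <= k)%N then (k - l)`!%:R^-1 else 0)).
  by rewrite -H4//; congr (_ + _); apply: eq_bigr => j _; rewrite ww'.
by congr (_ + _); apply: eq_big_nat => l lp; rewrite ww'.
Qed.

Section one_partition.
Context {R : realType} {s r : nat}.
Implicit Type G : glm R s r.

Definition pglm_of_glm G : pglm R 1 s r :=
  Pglm (fun _ => glm_c G) (fun _ _ => glm_A G) (fun _ _ => glm_U G)
       (fun _ _ => glm_B G) (fun _ _ => glm_V G).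

Lemma near_right_shift (P : R -> Prop) (t : R) :
  (\forall u \near t, P u) -> \forall h \near 0^'+, P (t + h).
Proof.
move=> tP; have : (t + h) @[h --> 0^'+] --> t.
  rewrite -[X in _ --> X]addr0; apply: cvg_at_right_filter.
  by apply: cvgD; [exact: cvg_cst|exact: cvg_id].
by apply.
Qed.

(** Both forms agree because [y] and [f] along [y] have matching derivatives wherever [y] solves the
    equation. A neighbourhood of [t] is needed, as the outputs are compared at [t + h]. *)
Lemma glm_externalE d p (W : 'M[R]_(r, p.+1)) (f : 'rV[R]_d -> 'rV[R]_d)
    (y : R -> 'rV[R]_d) (t : R) : smooth f -> solves_near f y t ->
  \forall u \near t, forall h i, glm_external W y h u i =
    pglm_external p (fun (_ : 'I_1) i => W i ord0)
      (fun (_ _ : 'I_1) i k => W i (inord k)) (fun=> f) y h u ord0 i.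
Proof.
move=> sf sol.
have sol1 : solves_near (fun x => \sum_(sigma < 1) f x) y t.
  by apply: filterS sol => u; rewrite big_ord1.
have H : \forall u \near t, forall k : 'I_p,
    derive1n k.+1 y u = derive1n k (fun v => f (y v)) u.
  apply: (@filter_forall _ _ (fun (k : 'I_p) u =>
    derive1n k.+1 y u = derive1n k (fun v => f (y v)) u) (nbhs t) (nbhs_filter t)).
  move=> k; apply: filterS (derive1n_sol (fun=> sf) sol1 k) => u ->.
  by rewrite big_ord1.
apply: filterS H => u Hu h i.
rewrite /glm_external /pglm_external big_ord_recl expr0 mulr1; congr (_ + _).
rewrite big_ord1 big_add1/= big_mkord; apply: eq_bigr => k _.
rewrite /= /bump add1n -derive1nS add0n Hu; congr ((W i _ * _) *: _).
by apply: val_inj; rewrite /= inordK// ltnS.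
Qed.

Lemma glm_order_withP p q G (W : 'M[R]_(r, p.+1)) :
  glm_order_with q G W <->
  pglm_order_with p q (pglm_of_glm G) (fun _ i => W i ord0)
    (fun _ _ i k => W i (inord k)).
Proof.
split=> H d f y t xi Y xi' sf sol step bY Hxi.
  have fE : f = fun=> f ord0 by apply/funext => i; rewrite ord1.
  have sol0 : solves_near (f ord0) y t.
    by apply: filterS sol => u; rewrite big_ord1.
  have ext := glm_externalE W (sf ord0) sol0.
  have [|||HY Hxi'] := H d (f ord0) y t (fun h => xi h ord0)
      (fun h => Y h ord0) (fun h => xi' h ord0) (sf ord0) sol0.
  - apply: filterS step => h [H1 H2]; split=> i; [rewrite H1|rewrite H2];
      by rewrite !big_ord1.
  - by move=> i; exact: bY.
  - move=> i; apply: Oh_near (Hxi ord0 i); near=> h.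
    by rewrite (nbhs_singleton ext) -fE.
  split=> mu i; rewrite ord1; first exact: HY.
  apply: Oh_near (Hxi' i); apply: filterS (near_right_shift ext) => h E; congr (_ - _).
  by rewrite fE; exact: E.
have sol1 : solves_near (fun x => \sum_(sigma < 1) f x) y t.
  by apply: filterS sol => u; rewrite big_ord1.
have ext := glm_externalE W sf sol.
have [|||HY Hxi'] := H d (fun=> f) y t (fun h _ => xi h) (fun h _ => Y h)
    (fun h _ => xi' h) (fun=> sf) sol1.
- apply: filterS step => h [H1 H2]; split=> ? i; [rewrite H1|rewrite H2];
    by rewrite !big_ord1.
- by move=> _ i; exact: bY.
- move=> mu i; apply: Oh_near (Hxi i); near=> h.
  by rewrite (nbhs_singleton ext) ord1.
split=> i; first exact: (HY ord0).
apply: Oh_near (Hxi' ord0 i); by apply: filterS (near_right_shift ext) => h ->.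
Unshelve. all: by end_near. Qed.

End one_partition.

Section pairs.
Context {R : realType} {s r : nat}.

Lemma glm_order_cond p q (G : glm R s r) (W : 'M[R]_(r, p.+1)) :
  (1 <= p)%N -> (q <= p <= q.+1)%N ->
  glm_order_with q G W <->
  order_cond p q (glm_c G) (glm_A G) (glm_U G) (glm_B G) (glm_V G)
    (fun i => W i ord0) (fun i k => W i (inord k)).
Proof.
move=> p1 pq; rewrite glm_order_withP.
(* With one partition every block is diagonal, so any value may stand off the diagonal. *)
have block (T : Type) (mu sigma : 'I_1) (x z : T) : x = if mu == sigma then x else z.
  by rewrite !ord1.
split=> H.
  exact: (@pglm_order_cond _ 1 s r p q (glm_c G) (glm_U G) (glm_V G) (pglm_of_glm G)
    _ _ _ _ _ H p1 pq ord0 ord0).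
by apply: (@order_cond_pglm _ 1 s r p q (glm_c G) (glm_U G) (glm_V G)).
Qed.

End pairs.

(** * Equivalence of the orders for an ADI pattern *)

Theorem theorem1 (R : realType) (N s r p q : nat) (GE GI : glm R s r)
    (impl : 'I_N -> 'I_N -> bool) (M : pglm R N s r) :
  (1 <= p)%N -> q = p \/ q = p.-1 -> (2 <= N)%N ->
  glm_explicit GE -> glm_implicit GI ->
  glm_c GE = glm_c GI -> glm_U GE = glm_U GI -> glm_V GE = glm_V GI ->
  adi_glm GE GI impl M ->
  (pglm_order p q M <-> glm_pair_order p q GE GI).
Proof.
move=> p1 hq _ _ _ cE UE VE [[mu [sigma [tau [impS expT]]]] Mc MAB MU MV].
have pq : (q <= p <= q.+1)%N.
  by case: hq => ->; rewrite ?leqnn ?leqnSn// leq_pred prednK/=.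
have qp : (q <= p)%N by case/andP: pq.
have AB nu rho : (pglm_A M nu rho = if impl nu rho then glm_A GI else glm_A GE) *
    (pglm_B M nu rho = if impl nu rho then glm_B GI else glm_B GE).
  by have := MAB nu rho; case: ifP => _ [-> ->].
split=> [[w0 [w H]]|[WE [WI [HE HI WEI]]]].
  have oc := pglm_order_cond Mc MU MV H p1 pq mu.
  (* Column 0 of [W rho] does not involve [rho]: this gives the explicit matrix [W tau] and the
     implicit matrix [W sigma] the same first column. *)
  pose W rho : 'M[R]_(r, p.+1) :=
    \matrix_(i, k) if k == ord0 then w0 mu i else w mu rho i k.
  have ocW rho : order_cond p q (glm_c GE) (pglm_A M mu rho) (glm_U GE)
      (pglm_B M mu rho) (glm_V GE) (fun i => W rho i ord0)
      (fun i k => W rho i (inord k)).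
    apply: order_cond_ext (oc rho) => // [i|i k /andP[k0 kp]]; first by rewrite mxE.
    by rewrite mxE -val_eqE /= inordK// gtn_eqF.
  exists (W tau), (W sigma); split; last by move=> i; rewrite !mxE.
    apply/glm_order_cond => //; have := ocW tau.
    by rewrite !AB (negbTE expT).
  apply/glm_order_cond => //; have := ocW sigma.
  by rewrite !AB impS -cE -UE -VE.
(* All block rows carry the common first column, and each block takes the remaining columns from the
   method it uses. *)
exists (fun _ i => WE i ord0),
  (fun nu rho i k => if impl nu rho then WI i (inord k) else WE i (inord k)).
move/(glm_order_cond _ _ p1 pq): HE => HE; move/(glm_order_cond _ _ p1 pq): HI => HI.
apply: (order_cond_pglm Mc MU MV pq) => nu rho.
rewrite !AB; case: (impl nu rho) => //.
rewrite cE UE VE; apply: order_cond_ext HI => // i; exact/esym.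
Qed.
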